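(* Let $d\ge1$, let $\triangle^d=\{x\in\mathbb{R}^d: x_1\ge0,\dots,x_d\ge 0,\ \sum_{i=1}^d x_i\le 1\}$, and let $\mu$ be the equilibrium measure of $\triangle^d$, i.e. the probability measure on $\triangle^d$ proportional to $$\frac{dx}{\sqrt{x_1}\cdots\sqrt{x_d}\,\sqrt{1-\sum_{j=1}^d x_j}}.$$ For $\varepsilon\in\{0,1\}^{d+1}$ let $|\varepsilon|=\sum_{i=1}^{d+1}\varepsilon_i$, $|x|=\sum_{i=1}^d x_i$, and $$g_\varepsilon(x)=x_1^{\varepsilon_1}\cdots x_d^{\varepsilon_d}\,(1-|x|)^{\varepsilon_{d+1}},\qquad x\in\mathbb{R}^d,$$ and let $g_\varepsilon\cdot\mu$ be the (not normalized) measure $g_\varepsilon\,d\mu$ on $\triangle^d$. Then for every $m\in\mathbb{N}$ and $x\in\mathbb{R}^d$, $$\sum_{\varepsilon\in\{0,1\}^{d+1};\ |\varepsilon|\in2\mathbb{N};\ |\varepsilon|\le 2m} g_\varepsilon(x)\,P^{g_\varepsilon\cdot\mu}_{m-|\varepsilon|/2}(x,x)=\binom{2m+d-1}{d-1}+\binom{2m+d-2}{d-1}.$$ As a consequence, for every $n\in\mathbb{N}$ and $x\in\mathbb{R}^d$, $$\sum_{\varepsilon\in\{0,1\}^{d+1};\ |\varepsilon|\in2\mathbb{N};\ |\varepsilon|\le 2n} g_\varepsilon(x)\,\Lambda^{g_\varepsilon\cdot\mu}_{n-|\varepsilon|/2}(x)^{-1}=\binom{2n+d}{d}.$$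
   Context: $\mathbb{N}=\{0,1,2,\dots\}$ and $2\mathbb{N}$ is the set of even nonnegative integers; $\mathbb{R}[x]_n$ is the space of real polynomials in $x=(x_1,\dots,x_d)$ of total degree at most $n$. For a finite nonnegative Borel measure $\nu$ (not necessarily a probability measure) with compact support and $\int p^2\,d\nu>0$ for all nonzero polynomials $p$, let $\mathcal{V}_m$ be the space of polynomials of degree $m$ orthogonal in $L^2(\nu)$ to all polynomials of degree less than $m$ (together with $0$). For any orthonormal basis $(P_\alpha)_{|\alpha|=m}$ of $\mathcal{V}_m$ in $L^2(\nu)$, $P^\nu_m(x,y)=\sum_{|\alpha|=m}P_\alpha(x)P_\alpha(y)$, the reproducing kernel of $\mathcal V_m$ (independent of the basis). The Christoffel function is $\Lambda^\nu_n(\xi)=\inf\{\int p^2\,d\nu: p\in\mathbb{R}[x]_n,\ p(\xi)=1\}$; equivalently $\Lambda^\nu_n(x)^{-1}=\sum_{m=0}^n P^\nu_m(x,x)$ for all $x\in\mathbb{R}^d$. Convention: $\binom{a}{b}=0$ whenever $a<b$ (including negative $a$). *)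

(* Defs.v *)
From HB Require Import structures.
From mathcomp Require Import all_boot all_order all_algebra.
(* The notations of mpoly clash with those of mathcomp-analysis; mpoly comes
   first because its isMeasure must not hide the one of mathcomp-analysis. *)
From mathcomp Require Import -(notations) mpoly.
From mathcomp Require Import all_classical all_reals all_analysis.
From mathcomp Require Import measurable_realfun.

Set Implicit Arguments.
Unset Strict Implicit.
Unset Printing Implicit Defensive.

Import Order.TTheory GRing.Theory Num.Theory.
Import numFieldNormedType.Exports.

Local Open Scope classical_set_scope.
Local Open Scope ring_scope.

(* R^d is d.-tuple R with its product sigma-algebra, which is the Borel one. *)

Section lebesgue_tuple.
Context {R : realType}.

Definition cons_tuple n (p : measurableTypeR R * n.-tuple R) : n.+1.-tuple R :=
  [tuple of p.1 :: p.2].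

Lemma measurable_cons_tuple n : measurable_fun setT (@cons_tuple n).
Proof.
exact: (@measurable_cons _ _ (measurableTypeR R * n.-tuple R)%type R
  (fun p => p.1) n (fun p => p.2) measurable_fst measurable_snd).
Qed.

Section step.
Variables (n : nat) (mu : {sigma_finite_measure set (n.-tuple R) -> \bar R}).

Definition lebesgue_step : set (n.+1.-tuple R) -> \bar R :=
  pushforward ((@lebesgue_measure R) \x mu)%E (@cons_tuple n).

Let step0 : lebesgue_step set0 = 0%E.
Proof. by rewrite /lebesgue_step /pushforward preimage_set0 measure0. Qed.

Let step_ge0 A : (0 <= lebesgue_step A)%E.
Proof. by rewrite /lebesgue_step /pushforward; exact: measure_ge0. Qed.

Let step_sigma_additive : semi_sigma_additive lebesgue_step.
Proof.
move=> F mF tF mUF; rewrite /lebesgue_step /pushforward preimage_bigcup.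
have mp A : measurable A -> measurable (@cons_tuple n @^-1` A).
  by move=> mA; rewrite -[X in measurable X]setTI; exact: measurable_cons_tuple.
apply: measure_semi_sigma_additive.
- by move=> k; exact: mp.
- apply/trivIsetP => /= i j _ _ ij; rewrite -preimage_setI.
  by move/trivIsetP : tF => /(_ _ _ _ _ ij) ->//; rewrite preimage_set0.
- by rewrite -preimage_bigcup; exact: mp.
Qed.

HB.instance Definition _ := isMeasure.Build _ _ _ lebesgue_step
  step0 step_ge0 step_sigma_additive.

Let step_sigma_finite : sigma_finite setT lebesgue_step.
Proof.
have /sigma_finiteP[F [FT Fnd Ffin]] := sigma_finiteT mu.
have /sigma_finiteP[G [GT Gnd Gfin]] := sigma_finiteT (@lebesgue_measure R).
pose H k : set (n.+1.-tuple R) :=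
  (fun t : n.+1.-tuple R => thead t) @^-1` (G k) `&` (fun t : n.+1.-tuple R => [tuple of behead t]) @^-1` (F k).
have cH k : @cons_tuple n @^-1` (H k) = G k `*` F k.
  have bK a (b : n.-tuple R) : [tuple of behead [tuple of a :: b]] = b.
    exact/val_inj.
  rewrite /H; apply/seteqP; split=> -[a b]; rewrite /cons_tuple /= theadE.
    by rewrite bK.
  by rewrite bK.
exists H.
  apply/esym; rewrite -subTset => t _.
  have [i _ Gi] : (\bigcup_i G i) (thead t) by rewrite -GT.
  have [j _ Fj] : (\bigcup_i F i) [tuple of behead t] by rewrite -FT.
  exists (maxn i j) => //; split => /=.
    by have /subsetPset := Gnd _ _ (leq_maxl i j); exact.
  by have /subsetPset := Fnd _ _ (leq_maxr i j); exact.
move=> k; have [mF Foo] := Ffin k; have [mG Goo] := Gfin k; split.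
  apply: measurableI.
    rewrite -[X in measurable X]setTI.
    exact: (@measurable_tnth _ R n.+1 ord0).
  by rewrite -[X in measurable X]setTI; exact: (@measurable_behead _ R n).
rewrite /lebesgue_step /pushforward cH product_measure1E//.
by rewrite lte_mul_pinfty// ge0_fin_numE.
Qed.

HB.instance Definition _ := @Measure_isSigmaFinite.Build _ _ _ lebesgue_step
  step_sigma_finite.

End step.

(* Lebesgue measure on R^n: on R^(n+1) it is the image of the product of the
   Lebesgue measures on R and R^n under the identification (a, t) |-> a :: t. *)
Fixpoint lebesgue_tuple n : {sigma_finite_measure set (n.-tuple R) -> \bar R} :=
  if n is k.+1 then lebesgue_step (lebesgue_tuple k) else \d_[tuple].

End lebesgue_tuple.

Section density.
Local Open Scope ereal_scope.
Context d (T : measurableType d) (R : realType).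
Variables (mu : {measure set T -> \bar R}) (D : set T) (f : T -> R).

(* The measure f . mu on D (extended by 0 outside of D). *)
Definition mdensity & measurable D & measurable_fun D f
    & (forall x, D x -> (0 <= f x)%R) : set T -> \bar R :=
  fun A => \int[mu]_(x in A `&` D) (f x)%:E.

Hypotheses (mD : measurable D) (mf : measurable_fun D f).
Hypothesis f0 : forall x, D x -> (0 <= f x)%R.

Local Notation density := (mdensity mD mf f0).

Let density0 : density set0 = 0.
Proof. by rewrite /mdensity set0I integral_set0. Qed.

Let density_ge0 A : 0 <= density A.
Proof. by apply: integral_ge0 => x [_ Dx]; rewrite lee_fin f0. Qed.

Let density_sigma_additive : semi_sigma_additive density.
Proof.
move=> F mF tF mUF; rewrite /mdensity setI_bigcupl ge0_integral_bigcup//=.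
- apply: is_cvg_ereal_nneg_natsum_cond => n _ _.
  by apply: integral_ge0 => x [_ Dx]; rewrite lee_fin f0.
- by move=> k; exact: measurableI.
- apply/measurable_EFinP; apply: measurable_funS mf => //.
  by rewrite -setI_bigcupl; exact: subIsetr.
- by move=> x [k _ [_ Dx]]; rewrite lee_fin f0.
- exact: trivIset_setIr.
Qed.

HB.instance Definition _ := isMeasure.Build _ _ _ density
  density0 density_ge0 density_sigma_additive.

End density.

Section orthogonal_polynomials.
Context {R : realType} {d : nat}.

Local Notation msize p := (mmeasure mdeg p).

Definition peval (p : mpoly d R) (x : d.-tuple R) : R := meval (tnth x) p.

Variable nu : {measure set (d.-tuple R) -> \bar R}.

Definition pdot (p q : mpoly d R) : R := \int[nu]_x (peval p x * peval q x).

(* p has degree m and is orthogonal to all polynomials of smaller degree, or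
   p = 0; recall that msize is 1 + the total degree, and 0 for p = 0. *)
Definition ortho_space (m : nat) (p : mpoly d R) : Prop :=
  p = 0 \/
  (msize p = m.+1 /\ forall q, (msize q <= m)%N -> pdot p q = 0).

(* Only the values of P at the multi-indices a with |a| = m are relevant. *)
Definition orthonormal_basis (m : nat) (P : multinom d -> mpoly d R) : Prop :=
  [/\ forall a, mdeg a = m -> ortho_space m (P a),
      forall a b, mdeg a = m -> mdeg b = m -> pdot (P a) (P b) = (a == b)%:R
    & forall p, ortho_space m p -> exists c : multinom d -> R,
        p = \sum_(a : bmultinom d m.+1 | mdeg a == m) c a *: P a].

(* The reproducing kernel of ortho_space m, computed in a chosen orthonormal
   basis; such bases exist, and all give the same kernel, when nu has finite
   moments and \int p^2 dnu > 0 for p != 0. *)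
Definition ortho_kernel (m : nat) (x y : d.-tuple R) : R :=
  let P := xget (fun=> 0) [set P | orthonormal_basis m P] in
  \sum_(a : bmultinom d m.+1 | mdeg a == m) peval (P a) x * peval (P a) y.

Definition christoffel (n : nat) (xi : d.-tuple R) : R :=
  inf [set pdot p p | p in [set p | (msize p <= n.+1)%N /\ peval p xi = 1]].

End orthogonal_polynomials.

Section simplex.
Context (R : realType) (d : nat).

Definition tsum (x : d.-tuple R) : R := \sum_(i < d) tnth x i.

Definition simplex : set (d.-tuple R) :=
  [set x | (forall i, 0 <= tnth x i) /\ tsum x <= 1].

(* As 0^-1 = 0 this vanishes on the boundary of the simplex, a null set. *)
Definition eqweight (x : d.-tuple R) : R :=
  ((\prod_(i < d) Num.sqrt (tnth x i)) * Num.sqrt (1 - tsum x))^-1.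

(* {0,1}^(d+1) is d.+1.-tuple bool; ord_max is the last index d+1. *)
Definition abs_eps (e : d.+1.-tuple bool) : nat :=
  (\sum_(i < d.+1) tnth e i)%N.

Definition gfun (e : d.+1.-tuple bool) (x : d.-tuple R) : R :=
  (\prod_(i < d) tnth x i ^+ tnth e (widen_ord (leqnSn d) i))
    * (1 - tsum x) ^+ tnth e ord_max.

Lemma measurable_tsum : measurable_fun setT tsum.
Proof. by apply: measurable_sum => i; exact: measurable_tnth. Qed.

Lemma measurable_simplex : measurable simplex.
Proof.
have -> : simplex = \bigcap_(i : 'I_d) ((@tnth _ R)^~ i @^-1` `[0, +oo[)
                    `&` (tsum @^-1` `]-oo, 1]).
  apply/seteqP; split=> x [].
    by move=> x0 x1; split => /= [i _|]; rewrite /= in_itv/= ?andbT.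
  move=> x0; rewrite /= in_itv/= => x1; split => // i.
  by have := x0 i I; rewrite /= in_itv/= andbT.
apply: measurableI.
  apply: fin_bigcap_measurable => // i _.
  by rewrite -[X in measurable X]setTI; exact: measurable_tnth.
by rewrite -[X in measurable X]setTI; exact: measurable_tsum.
Qed.

Lemma measurable_eqweight : measurable_fun simplex eqweight.
Proof.
apply: (@measurable_funS _ _ _ _ setT) => //.
have msqrt : measurable_fun [set: R] (@Num.sqrt R).
  by apply: continuous_measurable_fun; exact: sqrt_continuous.
pose h (x : d.-tuple R) : R :=
  \prod_(i < d) Num.sqrt (tnth x i) * Num.sqrt (1 - tsum x).
have -> : eqweight = (fun y : R => y `^ (- 1)) \o h.
  apply/funext => x; rewrite /eqweight /= powR_inv1// mulr_ge0 ?sqrtr_ge0//.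
  by apply: prodr_ge0 => i _; exact: sqrtr_ge0.
apply: measurableT_comp; first exact: measurable_powR.
apply: measurable_funM.
  apply: measurable_prod => i _; apply: measurableT_comp => //.
  exact: measurable_tnth.
apply: measurableT_comp => //; apply: measurable_funB => //.
exact: measurable_tsum.
Qed.

Lemma measurable_gfun e : measurable_fun simplex (gfun e).
Proof.
apply: (@measurable_funS _ _ _ _ setT) => //; apply: measurable_funM.
  apply: measurable_prod => i _; apply: measurable_funX.
  exact: measurable_tnth.
apply: measurable_funX; apply: measurable_funB => //; exact: measurable_tsum.
Qed.

Lemma eqweight_ge0 x : simplex x -> 0 <= eqweight x.
Proof.
move=> _; rewrite /eqweight invr_ge0 mulr_ge0 ?sqrtr_ge0//.
by apply: prodr_ge0 => i _; exact: sqrtr_ge0.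
Qed.

Lemma gfun_ge0 e x : simplex x -> 0 <= gfun e x.
Proof.
move=> [x0 x1]; apply: mulr_ge0; last by rewrite exprn_ge0 ?subr_ge0.
by apply: prodr_ge0 => i _; exact: exprn_ge0.
Qed.

(* mnormalize divides by the total mass; its second argument is the value in
   case this mass is 0 or +oo, which does not occur here. *)
Definition equilibrium : probability (d.-tuple R) R :=
  mnormalize (mdensity (lebesgue_tuple d) measurable_simplex measurable_eqweight
    eqweight_ge0) (@dirac _ (d.-tuple R) [tuple of nseq d 0] R).

Definition gequilibrium (e : d.+1.-tuple bool) :
    {measure set (d.-tuple R) -> \bar R} :=
  mdensity equilibrium measurable_simplex (@measurable_gfun e) (@gfun_ge0 e).

End simplex.

(* Binomial coefficient with integer upper argument, 0 when a < b; in
   particular binz (-1) 0 = 0, unlike with truncated subtraction. *)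
Definition binz (a : int) (b : nat) : nat :=
  if a is Posz n then 'C(n, b) else 0%N.

(* Main.v *)
Require Import Defs.
From HB Require Import structures.
From mathcomp Require Import all_boot all_order all_algebra.
From mathcomp Require Import -(notations) mpoly.
From mathcomp Require Import all_classical all_reals all_analysis.
From mathcomp Require Import measurable_realfun ring lra zify.

(** Put [x_i = u_i^2]: the squaring map from the unit sphere of R^(d+1) to the
simplex sends the uniform measure to mu, and [1 - |x|] is the square of the
last coordinate [u_(d+1)].  An even polynomial of degree at most [2n] on the
sphere splits by parity as the sum over [e] with [|e|] even of
[u^e p_e(u^2)], where [deg p_e <= n - |e|/2]; the pieces are orthogonal, and
[p |-> u^e p(u^2)] is an isometry from L^2(g_e mu).  Hence the sum of
[g_e(x)] times the diagonal kernels of [g_e mu] is the diagonal of the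
reproducing kernel of the even polynomials of degree at most [2n] on the
sphere.  That function is rotation invariant, so it is constant, and its
integral is the dimension of the space, which is 'C(2n + d, d).

The sphere itself does not appear below.  Infinitesimal rotations suffice, and
among them the fields [D_i = u_i d_(d+1) - u_(d+1) d_i], which vanish on a
function of [x] exactly when its derivative in [x_i] does.  Such a field maps
[u^e p] to [u^e' T_e p], where [e'] is [e] with its entries i and d+1
complemented ([flip]) and [T_e] is a first order operator in [x]
([rotation]).  Invariance of the measure says that the [T_e] are
skew-adjoint ([rotation_adjoint]), and this reduces to one integration by parts
between [x_i] and [1 - |x|] ([eqint_by_parts]).  If [f_a] runs over orthonormal
bases of the spaces for the various [e], the derivative in [x_i] of the sum of
the [g_e f_a^2] is a sum of products [f_a T_e f_a]; expanding [T_e f_a] in the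
basis for [e'] makes it a skew-symmetric sum, so it vanishes
([mderiv_kernel_sum]).  The sum is therefore a constant polynomial, equal to
its own integral, which counts basis elements ([kernel_sum_const]); the count
is the bijection [b |-> (parities of b, b/2)] on multi-indices
([sum_card_bmultinom]).

The analytic input is thus small.  Tonelli's theorem brings the integration by
parts down to the half-integer powers on a segment ([hipow_conv_by_parts],
[dirichlet_by_parts]).  The mass is finite, and nonzero polynomials vanish only
on null sets ([null_zero_set]), so the forms are positive definite
([eqint_gt0]) and orthonormal bases exist by the Gram-Schmidt process.

By the Cauchy-Schwarz inequality the inverse Christoffel function is the
diagonal kernel of all the polynomials up to the given degree
([christoffelE]).  The second identity is then the constancy just explained,
and the first is the difference of two consecutive instances of it. *)

Set Implicit Arguments.
Unset Strict Implicit.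
Unset Printing Implicit Defensive.

Import Order.TTheory GRing.Theory Num.Theory.
Import numFieldNormedType.Exports.

Local Open Scope ring_scope.

(** * Counting multi-indices by parity *)

Section counting.
Variable d : nat.
Local Notation wid := (widen_ord (leqnSn d)).
Implicit Types (a b : multinom d) (e : d.+1.-tuple bool).

Lemma mnm_le_mdeg n (m : multinom n) i : (m i <= mdeg m)%N.
Proof. by rewrite mdegE (bigD1 i)//= leq_addr. Qed.

Lemma card_bmultinom N : #|{: bmultinom d N.+1}| = 'C(N + d, d).
Proof.
rewrite addnC -card_partial_ord_partitions.
pose h (a : bmultinom d N.+1) : d.-tuple 'I_N.+1 := [tuple inord (bmnm a i) | i < d].
have hE (a : bmultinom d N.+1) i : tnth (h a) i = bmnm a i :> nat.
  rewrite tnth_mktuple inordK//; apply: leq_ltn_trans (bmdeg a); exact: mnm_le_mdeg.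
have hinj : injective h.
  by move=> a a' aa'; apply/val_inj/mnmP => i; rewrite -!hE aa'.
rewrite -cardsT -(card_imset _ hinj); apply: eq_card => t; rewrite inE.
apply/imsetP/idP => [[a _ ->]|tN].
  rewrite big_tuple (eq_bigr (fun i => bmnm a i)) => [|i _]; last exact: hE.
  by rewrite -mdegE -ltnS bmdeg.
pose m : multinom d := Multinom [tuple tnth t i : nat | i < d].
have mE i : m i = tnth t i by rewrite mnmE.
have mN : (mdeg m < N.+1)%N.
  rewrite ltnS mdegE; move: tN; rewrite big_tuple; congr (_ <= _)%N.
  by apply: eq_bigr => i _; rewrite mE.
exists (BMultinom mN) => //; apply: eq_from_tnth => i; apply/val_inj.
by rewrite /= hE /= mE.
Qed.

(** The last entry is the parity of [2n - |b|], the exponent of an additional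
    variable that makes the monomial homogeneous of degree [2n]. *)
Definition parity b : d.+1.-tuple bool :=
  [tuple if unlift ord_max j is Some i then odd (b i) else odd (mdeg b) | j < d.+1].

Lemma parity_wid b i : tnth (parity b) (wid i) = odd (b i).
Proof.
rewrite tnth_mktuple (_ : wid i = lift ord_max i) ?liftK//.
by apply/val_inj; rewrite /= /bump leqNgt ltn_ord.
Qed.

Lemma parity_max b : tnth (parity b) ord_max = odd (mdeg b).
Proof. by rewrite tnth_mktuple unlift_none. Qed.

Lemma abs_eps_recr e : abs_eps e = (\sum_(i < d) tnth e (wid i) + tnth e ord_max)%N.
Proof. by rewrite /abs_eps big_ord_recr. Qed.

Lemma odd_parity b : ~~ odd (abs_eps (parity b)).
Proof.
rewrite abs_eps_recr parity_max oddD oddb.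
rewrite (eq_bigr (fun i => odd (b i) : nat)); last by move=> i _; rewrite parity_wid.
suff -> : odd (\sum_(i < d) odd (b i)) = odd (mdeg b) by rewrite addbb.
rewrite mdegE; apply: (big_rec2 (fun x y => odd x = odd y)) => // i x y _ xy.
by rewrite !oddD oddb xy.
Qed.

(** The fiber is the image of the injection [a |-> 2a + (e_1, .., e_d)].  When
    [|e|/2 > n] both sides are empty: the truncated difference is then [0], and no
    multi-index has degree less than [0]. *)
Lemma card_parity_fiber n e : ~~ odd (abs_eps e) ->
  #|[set b : bmultinom d (2 * n).+1 | parity b == e]| =
  #|{: bmultinom d (n.+1 - (abs_eps e)./2)}|.
Proof.
move=> oe; have eE := abs_eps_recr e; have e2 := even_halfK oe.
pose m a : multinom d := Multinom [tuple (2 * a i + tnth e (wid i))%N | i < d].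
have mE a i : m a i = (2 * a i + tnth e (wid i))%N by rewrite mnmE.
have mdegm a : mdeg (m a) = (2 * mdeg a + \sum_(i < d) tnth e (wid i))%N.
  rewrite !mdegE (eq_bigr (fun i => (2 * a i + tnth e (wid i))%N)) => [|i _]; last exact: mE.
  by rewrite big_split /= big_distrr.
have mN (a : bmultinom d (n.+1 - (abs_eps e)./2)) : (mdeg (m a) < (2 * n).+1)%N.
  rewrite mdegm; have := bmdeg a; have := leq_b1 (tnth e ord_max).
  move: (nat_of_bool _) (\sum_(i < d) _)%N eE => u v eE; lia.
pose h (a : bmultinom d (n.+1 - (abs_eps e)./2)) : bmultinom d (2 * n).+1 := BMultinom (mN a).
have hinj : injective h.
  move=> a a' /(congr1 val) /= /mnmP aa'; apply/val_inj/mnmP => i.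
  by have := aa' i; rewrite !mE => /addIn/eqP; rewrite eqn_pmul2l// => /eqP.
rewrite -[RHS]cardsT -(card_imset _ hinj); apply: eq_card => b; rewrite inE.
apply/eqP/imsetP => [be|[a _ ->]].
  pose a : multinom d := Multinom [tuple (b i)./2 | i < d].
  have aE i : a i = (b i)./2 by rewrite mnmE.
  have bm : m a = bmnm b.
    by apply/mnmP => i; rewrite mE aE -be parity_wid addnC (mul2n (bmnm b i)./2) odd_double_half.
  have aN : (mdeg a < n.+1 - (abs_eps e)./2)%N.
    have := bmdeg b; rewrite -bm mdegm; have := leq_b1 (tnth e ord_max).
    move: (nat_of_bool _) (\sum_(i < d) _)%N eE => u v eE; lia.
  by exists (BMultinom aN) => //; apply/val_inj; rewrite /= bm.
apply: eq_from_tnth => j; have [i ->|->] := unliftP ord_max j.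
  rewrite (_ : lift ord_max i = wid i); last by apply/val_inj; rewrite /= /bump leqNgt ltn_ord.
  by rewrite parity_wid /= mE oddD mul2n odd_double oddb.
rewrite parity_max /= mdegm oddD mul2n odd_double /=.
by move: oe; rewrite eE oddD oddb; case: (odd _); case: (tnth _ _).
Qed.

(** Both sides count the multi-indices [b] with [|b| <= 2n]: writing
    [b = 2a + (e_1, .., e_d)], and letting the last entry of [e] be the parity of
    [|b|], the bound on [|b|] becomes [|a| <= n - |e|/2]. *)
Lemma sum_card_bmultinom n :
  (\sum_(e : d.+1.-tuple bool | ~~ odd (abs_eps e)) #|{: bmultinom d (n.+1 - (abs_eps e)./2)}|)%N
  = 'C(2 * n + d, d).
Proof.
rewrite -card_bmultinom -sum1_card.
rewrite (partition_big (fun b : bmultinom d (2 * n).+1 => parity b) (fun e => ~~ odd (abs_eps e))) /=;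
  last by move=> b _; exact: odd_parity.
by apply: eq_bigr => e oe; rewrite -card_parity_fiber// -sum1dep_card.
Qed.

End counting.

Local Open Scope classical_set_scope.
Local Open Scope ring_scope.

(** * Integrals on the line *)

Section improper.
Context {R : realType}.
Local Notation mu := (@lebesgue_measure R).

(** Fundamental theorem of calculus when the derivative is only integrable
    in the improper sense at the end points.  Splitting it as a difference of
    nonnegative functions, each with its own possibly infinite integral, lets
    monotone convergence along [[s/k, s - s/k]] do the work, and gives the statement a
    meaning when these integrals are infinite. *)
Lemma improper_FTC2 (s : R) (h P Q : R -> R) : 0 < s -> continuous h ->
  {in `]0, s[, continuous P} -> {in `]0, s[, continuous Q} ->
  (forall x, 0 <= P x) -> (forall x, 0 <= Q x) ->
  (forall x, x \in `]0, s[ -> is_derive x 1 h (P x - Q x)) ->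
  (\int[mu]_(x in `]0%R, s[) (P x)%:E + (h 0)%:E =
   \int[mu]_(x in `]0%R, s[) (Q x)%:E + (h s)%:E)%E.
Proof.
move=> s0 ch cP cQ P0 Q0 dh.
pose a n : R := s / n.+3%:R.
have a_gt0 n : 0 < a n by rewrite divr_gt0.
have a_le n : a n * 3 <= s.
  rewrite /a mulrAC ler_pdivrMr// ler_pM2l// ler_nat; lia.
have ab n : a n < s - a n by have := a_le n; have := a_gt0 n; lra.
have a_nincr m n : (m <= n)%N -> a n <= a m.
  by move=> mn; rewrite ler_pM2l// lef_pV2 ?posrE// ler_nat; lia.
have cva : a n @[n --> \oo] --> (0 : R).
  rewrite -(mulr0 s); apply: cvgM; first exact: cvg_cst.
  have := @cvg_harmonic R; rewrite -(cvg_shiftn 2) /=.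
  by apply: cvg_trans; apply: near_eq_cvg; near=> n; rewrite /= addn2.
pose A n : set R := `[a n, s - a n]%classic.
have ndA : nondecreasing_seq A.
  move=> m n mn; apply/subsetPset => x; rewrite /A /= !in_itv /= => /andP[? ?].
  by have := a_nincr _ _ mn; lra.
have AU : \bigcup_n A n = `]0, s[%classic.
  apply/seteqP; split=> x.
    by move=> [n _]; rewrite /A/= !in_itv/= => /andP[? ?]; have := a_gt0 n; lra.
  rewrite /= in_itv/= => /andP[x0 xs].
  have /cvgrPdist_lt/(_ (Num.min x (s - x))) := cva.
  have m0 : 0 < Num.min x (s - x) by rewrite lt_min; apply/andP; split; lra.
  move=> /(_ m0)[N _ /(_ N (leqnn _))]; rewrite sub0r normrN gtr0_norm//.
  by rewrite lt_min => /andP[? ?]; exists N => //; rewrite /A/= in_itv/=; lra.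
have AS n : {subset `[a n, s - a n] <= `]0, s[}.
  by move=> x; rewrite !in_itv/= => /andP[? ?]; have := a_gt0 n; lra.
have mA (f : R -> R) : {in `]0, s[, continuous f} -> forall n, measurable_fun (A n) (EFin \o f).
  move=> cf n; apply/measurable_EFinP.
  have mf : measurable_fun `]0, s[ f.
    apply: open_continuous_measurable_fun => //.
    by move=> x xs; apply: cf; move: xs; rewrite inE.
  by apply: measurable_funS mf => // x; exact: (AS n).
have icvg (f : R -> R) : {in `]0, s[, continuous f} -> (forall x, 0 <= f x) ->
  (\int[mu]_(x in A n) (f x)%:E @[n --> \oo] --> \int[mu]_(x in `]0%R, s[) (f x)%:E)%E.
  move=> cf f0; rewrite -AU; apply: ge0_nondecreasing_set_cvg_integral => //.
  - by move=> i; exact: measurable_itv.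
  - exact: (mA f cf).
  - by move=> i x _; rewrite lee_fin.
have wc (f : R -> R) n : {in `]0, s[, continuous f} -> {within `[a n, s - a n], continuous f}.
  by move=> cf; apply: continuous_in_subspaceT => x; rewrite inE => /AS/cf.
have ifin (f : R -> R) n : {in `]0, s[, continuous f} ->
    mu.-integrable (A n) (EFin \o f).
  by move=> cf; apply: continuous_compact_integrable; [exact: segment_compact|exact: wc].
have E n : (\int[mu]_(x in A n) (P x)%:E =
    \int[mu]_(x in A n) (Q x)%:E + (h (s - a n) - h (a n))%:E)%E.
  have cPQ : {in `]0, s[, continuous (P \- Q)}.
    by move=> x xs; apply: cvgB; [exact: cP|exact: cQ].
  have := @continuous_FTC2 R (P \- Q) h _ _ (ab n) (wc _ n cPQ).
  rewrite -/(A n) integralB_EFin//; try exact: ifin.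
  have dd x : x \in `]a n, s - a n[ -> is_derive x 1 h (P x - Q x).
    by rewrite in_itv/= => /andP[? ?]; apply: dh; rewrite in_itv/=; have := a_gt0 n; lra.
  rewrite -EFinB => <-.
  - rewrite addeCA subee ?adde0//.
    by apply: (integrable_fin_num _ (ifin Q n cQ)); exact: measurable_itv.
  - split; last 2 first.
    + by apply: cvg_at_right_filter; exact: ch.
    + by apply: cvg_at_left_filter; exact: ch.
    + by move=> x xa; have [] := dd _ xa.
  - by move=> x xa; rewrite derive1E; apply: derive_val; exact: dd.
  - exact: measurable_itv.
have cvd : (h (s - a n) - h (a n))%:E @[n --> \oo] --> (h s - h 0)%:E.
  apply: cvg_EFin; first exact: nearW.
  apply: cvgB.
    apply: (cvg_comp (fun n => s - a n) h _ (ch s)).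
    have := cvgB (cvg_cst s) cva; rewrite subr0; exact.
  exact: (cvg_comp a h cva (ch 0)).
have cvQ : (\int[mu]_(x in A n) (P x)%:E @[n --> \oo] -->
    \int[mu]_(x in `]0%R, s[) (Q x)%:E + (h s - h 0)%:E)%E.
  rewrite (_ : (fun n => _) = (fun n => \int[mu]_(x in A n) (Q x)%:E
      + (h (s - a n) - h (a n))%:E)%E); last by apply/funext => n; rewrite E.
  by apply: cvgeD; [exact: fin_num_adde_defl | exact: icvg | exact: cvd].
rewrite (cvg_unique _ (icvg P cP P0) cvQ) //.
by rewrite -addeA -EFinD subrK.
Unshelve. all: by end_near. Qed.

End improper.

Section hipow.
Context {R : realType}.
Implicit Types (k : nat) (s t : R).
Local Notation mu := (@lebesgue_measure R).

(** The power [t^(k - 1/2)].  As [Num.sqrt] vanishes on negative numbers and [0^-1 = 0],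
    it is [0] for [t <= 0]; integrals over a segment or a simplex thereby become
    integrals over the whole space. *)
Definition hipow k t : R := t ^+ k / Num.sqrt t.

Lemma hipow_npos k t : t <= 0 -> hipow k t = 0.
Proof. by move=> t0; rewrite /hipow ler0_sqrtr// invr0 mulr0. Qed.

Lemma hipow_ge0 k t : 0 <= hipow k t.
Proof.
have [t0|/ltW t0] := leP t 0; first by rewrite hipow_npos.
by rewrite mulr_ge0 ?invr_ge0 ?sqrtr_ge0 ?exprn_ge0.
Qed.

Lemma hipowS k t : hipow k.+1 t = t * hipow k t.
Proof. by rewrite /hipow exprS mulrA. Qed.

Lemma hipow1 t : hipow 1 t = Num.sqrt t.
Proof.
have [t0|t0] := leP t 0; first by rewrite hipow_npos// ler0_sqrtr.
rewrite /hipow expr1 -{1}(sqr_sqrtr (ltW t0)) expr2 mulfK//.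
by rewrite gt_eqF// sqrtr_gt0.
Qed.

Lemma measurable_hipow k : measurable_fun setT (hipow k).
Proof.
rewrite (_ : hipow k = (fun t => t ^+ k * ((fun y : R => y `^ (- 1)) \o Num.sqrt) t)).
  apply: measurable_funM; first exact: measurable_funX.
  apply: measurableT_comp; first exact: measurable_powR.
  by apply: continuous_measurable_fun; exact: sqrt_continuous.
by apply/funext => t /=; rewrite powR_inv1// sqrtr_ge0.
Qed.

Lemma continuous_hipow k t : 0 < t -> {for t, continuous (hipow k)}.
Proof.
move=> t0; apply: cvgM; first exact: exprn_continuous.
apply: cvgV; first by rewrite gt_eqF// sqrtr_gt0.
exact: sqrt_continuous.
Qed.

Lemma integral_supp (D : set R) (f : R -> R) : measurable D ->
  (forall x, ~ D x -> f x = 0) ->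
  (\int[mu]_x (f x)%:E = \int[mu]_(x in D) (f x)%:E)%E.
Proof.
move=> mD f0; rewrite [RHS]integral_mkcond; apply: eq_integral => x _.
by rewrite patchE; case: ifPn => // /negP; rewrite inE => /f0 ->.
Qed.

Lemma hipow_conv_supp k l s t :
  ~ `]0, s[%classic t -> hipow k t * hipow l (s - t) = 0.
Proof.
rewrite /= in_itv/= => ts; have [t0|t0] := leP t 0; first by rewrite hipow_npos// mul0r.
by rewrite (hipow_npos l) ?mulr0// leNgt; apply/negP; rewrite subr_gt0 => st; apply: ts; rewrite t0.
Qed.

Lemma continuous_subl s : continuous (fun t => s - t).
Proof. by move=> t; apply: cvgB; [exact: cvg_cst|exact]. Qed.

Lemma measurable_hipow_conv k l s :
  measurable_fun setT (fun t => hipow k t * hipow l (s - t)).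
Proof.
apply: measurable_funM; first exact: measurable_hipow.
apply: measurableT_comp; first exact: measurable_hipow.
by apply: continuous_measurable_fun; exact: continuous_subl.
Qed.

(** Integration by parts: the function [2 t^(k + 1/2) (s - t)^(1/2)] vanishes at [0]
    and at [s]. *)
Lemma hipow_conv_by_parts k s :
  (\int[mu]_t (hipow k.+1 t * hipow 0 (s - t))%:E =
   (2 * k + 1)%:R%:E * \int[mu]_t (hipow k t * hipow 1 (s - t))%:E)%E.
Proof.
have [s0|s0] := leP s 0.
  have z j l : (\int[mu]_t (hipow j t * hipow l (s - t))%:E = 0)%E.
    apply: integral0_eq => t _; rewrite hipow_conv_supp//= in_itv/=.
    by move=> /andP[]; lra.
  by rewrite !z mule0.
rewrite (integral_supp (measurable_itv `]0, s[)); last by move=> ?; exact: hipow_conv_supp.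
rewrite [in RHS](integral_supp (measurable_itv `]0, s[)); last by move=> ?; exact: hipow_conv_supp.
have cs k' l t : t \in `]0, s[ -> {for t, continuous (fun t => hipow k' t * hipow l (s - t))}.
  rewrite in_itv/= => /andP[t0 ts]; apply: cvgM; first exact: continuous_hipow.
  apply: (cvg_comp (fun t => s - t) (hipow l) (G := nbhs (s - t))); last first.
    by apply: continuous_hipow; rewrite subr_gt0.
  exact: continuous_subl.
rewrite -ge0_integralZl//; last 2 first.
- by apply: measurable_funTS; apply/measurable_EFinP; exact: measurable_hipow_conv.
- by move=> t _; rewrite lee_fin mulr_ge0// hipow_ge0.
have := @improper_FTC2 R s (fun t => 2 * (t ^+ k * Num.sqrt t * Num.sqrt (s - t)))
  (fun t => (2 * k + 1)%:R * (hipow k t * hipow 1 (s - t))) (fun t => hipow k.+1 t * hipow 0 (s - t)).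
rewrite /= sqrtr0 mulr0 mul0r mulr0 subrr sqrtr0 !mulr0 !adde0 => H.
apply/esym; refine (H _ _ _ _ _ _ _) => {H} //.
- move=> t; apply: cvgM; first exact: cvg_cst.
  apply: cvgM; last by apply: continuous_comp; [exact: continuous_subl|exact: sqrt_continuous].
  by apply: cvgM; [exact: exprn_continuous|exact: sqrt_continuous].
- move=> t ts; apply: cvgM; [exact: cvg_cst|exact: cs].
- by move=> t ts; exact: cs.
- by move=> t; apply: mulr_ge0 => //; apply: mulr_ge0; exact: hipow_ge0.
- by move=> t; apply: mulr_ge0; exact: hipow_ge0.
move=> t; rewrite in_itv/= => /andP[t0 ts].
have st0 : 0 < s - t by rewrite subr_gt0.
have d1 := is_derive1_sqrt t0.
have d2 := is_derive1_sqrt st0.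
have d3 : is_derive t 1 (fun t => Num.sqrt (s - t)) (- (2 * Num.sqrt (s - t))^-1).
  have d0 := is_deriveB (is_derive_cst s t 1) (is_derive_id t 1).
  have d7 : is_derive t 1 (fun t => s - t) (-1) by apply: (is_derive_eq d0); rewrite sub0r.
  have := @is_derive1_comp R Num.sqrt (fun t => s - t) t _ _ d2 d7; rewrite mulrN1; exact.
have d4 := is_deriveX k (is_derive_id t 1).
have d5 := is_deriveM (is_deriveM d4 d1) d3.
have d6 := is_deriveZ 2 d5.
(* The differentiation rules apply to products and scalings of functions. *)
rewrite (_ : (fun _ => _) = 2 \*: (id ^+ k * Num.sqrt * (fun t => Num.sqrt (s - t)))); last first.
  by apply/funext => u; rewrite !fctE.
apply: (is_derive_eq d6); rewrite hipow1 hipowS /hipow !fctE expr0 /=.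
have a0 : Num.sqrt t != 0 by rewrite gt_eqF// sqrtr_gt0.
have b0 : Num.sqrt (s - t) != 0 by rewrite gt_eqF// sqrtr_gt0.
have kE : k%:R * t ^+ k.-1 = k%:R * t ^+ k / t.
  case: k {cs d4 d5 d6} => [|k]; first by rewrite !mul0r.
  by rewrite /= exprS; field; rewrite gt_eqF.
rewrite kE /GRing.scale /= mulr1.
(* In terms of the two square roots the claim is an identity of rational functions. *)
have tE : t = Num.sqrt t ^+ 2 by rewrite sqr_sqrtr// ltW.
move: (Num.sqrt t) (Num.sqrt (s - t)) a0 b0 tE => a b a0 b0 tE.
rewrite natrD natrM; move: (t ^+ k) => w.
rewrite tE; field.
by rewrite a0 b0.
Qed.

Lemma integral_hipow0 s : 0 <= s ->
  (\int[mu]_(t in `]0%R, s[) (hipow 0 t)%:E = (2 * Num.sqrt s)%:E)%E.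
Proof.
rewrite le_eqVlt => /predU1P[<-|s0].
  by rewrite set_itvoo0 integral_set0 sqrtr0 mulr0.
have := @improper_FTC2 R s (fun t => 2 * Num.sqrt t) (hipow 0) (cst 0).
rewrite integral0 sqrtr0 mulr0 adde0 add0e => H.
refine (H _ _ _ _ _ _ _) => {H} //.
- by move=> t; apply: cvgM; [exact: cvg_cst|exact: sqrt_continuous].
- by move=> t; rewrite in_itv/= => /andP[t0 _]; exact: continuous_hipow.
- by move=> t _; exact: cvg_cst.
- by move=> t; exact: hipow_ge0.
move=> t; rewrite in_itv/= => /andP[t0 _].
apply: (is_derive_eq (is_deriveZ 2 (is_derive1_sqrt t0))).
rewrite /hipow expr0 subr0 /GRing.scale /=; field.
by rewrite gt_eqF// sqrtr_gt0.
Qed.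

(** The integral is in fact [pi] for every [s > 0].  Multiplying by
    [s = t + (s - t)] gives two integrals that are equal by parts, with the singularity
    at one end removed, each at most [s^(1/2)] times the integral of [t^(-1/2)]. *)
Lemma hipow_conv_le s :
  (\int[mu]_t (hipow 0 t * hipow 0 (s - t))%:E <= 4%:E)%E.
Proof.
have m0 k l : measurable_fun setT (fun t => (hipow k t * hipow l (s - t))%:E).
  by apply/measurable_EFinP; exact: measurable_hipow_conv.
have p0 k l t : 0 <= hipow k t * hipow l (s - t).
  by apply: mulr_ge0; exact: hipow_ge0.
have [s0|s0] := leP s 0.
  rewrite integral0_eq// => t _; rewrite hipow_conv_supp//= in_itv/=.
  by move=> /andP[]; lra.
have : (s%:E * \int[mu]_t (hipow 0 t * hipow 0 (s - t))%:E <= (s * 4)%:E)%E.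
  have -> : (s%:E * \int[mu]_t (hipow 0 t * hipow 0 (s - t))%:E =
      \int[mu]_t ((hipow 1 t * hipow 0 (s - t))%:E +
      (hipow 0 t * hipow 1 (s - t))%:E))%E.
    rewrite -ge0_integralZl//.
    - apply: eq_integral => t _; rewrite -EFinD -EFinM; congr EFin.
      by rewrite !hipowS; ring.
    - exact: m0.
    - by move=> t _; rewrite lee_fin.
    - by rewrite lee_fin ltW.
  rewrite ge0_integralD//; try exact: m0; try by move=> t _; rewrite lee_fin.
  rewrite hipow_conv_by_parts muln0 add0n mul1e.
  have le2 : (\int[mu]_t (hipow 0 t * hipow 1 (s - t))%:E <= (s * 2)%:E)%E.
    rewrite (integral_supp (measurable_itv `]0, s[)); last by move=> ?; exact: hipow_conv_supp.
    have mh : measurable_fun `]0, s[ (fun t => (hipow 0 t)%:E).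
      by apply: measurable_funTS; apply/measurable_EFinP; exact: measurable_hipow.
    apply: (@le_trans _ _ (\int[mu]_(t in `]0%R, s[) ((Num.sqrt s)%:E * (hipow 0 t)%:E))%E).
      apply: ge0_le_integral => //.
      - by move=> t _; rewrite lee_fin.
      - by apply: measurable_funTS; exact: m0.
      - by apply: measurable_funeM.
      - move=> t; rewrite /= in_itv/= => /andP[t0 ts].
        rewrite -EFinM lee_fin mulrC ler_wpM2r ?hipow_ge0// hipow1.
        by rewrite ler_wsqrtr//; lra.
    have -> : (\int[mu]_(t in `]0%R, s[) ((Num.sqrt s)%:E * (hipow 0 t)%:E) =
        (Num.sqrt s)%:E * \int[mu]_(t in `]0%R, s[) (hipow 0 t)%:E)%E.
      apply: ge0_integralZl => //.
        by move=> t _; rewrite lee_fin hipow_ge0.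
    rewrite (integral_hipow0 (ltW s0)) -EFinM lee_fin mulrCA -expr2 sqr_sqrtr ?(ltW s0)//.
    by rewrite mulrC.
  rewrite (_ : s * 4 = s * 2 + s * 2); last by ring.
  by rewrite EFinD leeD.
by rewrite EFinM lee_pmul2l// lte_fin.
Qed.

End hipow.

(** * Dirichlet integrals *)

Section tonelli.
Context {R : realType}.
Local Notation mu := (@lebesgue_measure R).
Local Notation lam := (@lebesgue_tuple R).

Section one.
Variables (n : nat) (f : n.+1.-tuple R -> \bar R).
Hypotheses (mf : measurable_fun setT f) (f0 : forall x, (0 <= f x)%E).

Let mfc : measurable_fun setT (f \o @Defs.cons_tuple R n).
Proof. by apply: measurableT_comp => //; exact: measurable_cons_tuple. Qed.

Let E : (\int[lam n.+1]_x f x = \int[mu \x lam n]_z (f \o @Defs.cons_tuple R n) z)%E.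
Proof.
rewrite [LHS](_ : _ = \int[pushforward (mu \x lam n) (@Defs.cons_tuple R n)]_x f x)%E //.
by rewrite (@ge0_integral_pushforward _ _ _ _ _ _ (@measurable_cons_tuple R n)) ?preimage_setT//.
Qed.

(** Lebesgue measure on tuples peels off the first coordinate only; having the
    iterated integral in both orders is what allows an integration in any
    coordinate by induction on the dimension. *)
Lemma integral_cons1 :
  (\int[lam n.+1]_x f x = \int[mu]_t \int[lam n]_y f (Defs.cons_tuple (t, y)))%E.
Proof. by rewrite E fubini_tonelli1; [|exact: mfc|move=> z; exact: f0]. Qed.

Lemma integral_cons2 :
  (\int[lam n.+1]_x f x = \int[lam n]_y \int[mu]_t f (Defs.cons_tuple (t, y)))%E.
Proof.
rewrite E fubini_tonelli1; [|exact: mfc|by move=> z; exact: f0].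
by rewrite fubini_tonelli; [|exact: mfc|move=> z; exact: f0].
Qed.

Lemma measurable_int_cons1 :
  measurable_fun setT (fun t : measurableTypeR R => \int[lam n]_y f (Defs.cons_tuple (t, y)))%E.
Proof. by apply: (@measurable_fun_fubini_tonelli_F _ _ _ _ _ (lam n) _ mfc) => z; exact: f0. Qed.

Lemma measurable_int_cons2 :
  measurable_fun setT (fun y => \int[mu]_t f (Defs.cons_tuple (t, y)))%E.
Proof. by apply: (@measurable_fun_fubini_tonelli_G _ _ _ _ _ mu _ mfc) => z; exact: f0. Qed.

End one.

Lemma tnth_cons0 n (t : R) (y : n.-tuple R) : tnth (Defs.cons_tuple (t, y)) ord0 = t.
Proof. by []. Qed.

Lemma tnth_consS n (t : R) (y : n.-tuple R) i :
  tnth (Defs.cons_tuple (t, y)) (lift ord0 i) = tnth y i.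
Proof. by rewrite tnthS. Qed.

Lemma tsum_cons n (t : R) (y : n.-tuple R) : tsum (Defs.cons_tuple (t, y)) = t + tsum y.
Proof.
by rewrite /tsum big_ord_recl; congr (_ + _); apply: eq_bigr => i _; rewrite tnth_consS.
Qed.

(** Integrand of the Dirichlet integral over the simplex [|x| <= s], with exponents
    [b_i - 1/2] and, for the last barycentric coordinate, [l - 1/2]. *)
Definition dirichlet_fun n (b : 'I_n -> nat) l (s : R) (x : n.-tuple R) : R :=
  \prod_(i < n) hipow (b i) (tnth x i) * hipow l (s - tsum x).

Definition dirichlet n (b : 'I_n -> nat) l (s : R) : \bar R :=
  (\int[lam n]_x (dirichlet_fun b l s x)%:E)%E.

Lemma dirichlet_fun_ge0 n (b : 'I_n -> nat) l s x : 0 <= dirichlet_fun b l s x.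
Proof.
by apply: mulr_ge0; [apply: prodr_ge0 => i _|]; exact: hipow_ge0.
Qed.

Lemma measurable_prod_hipow n (b : 'I_n -> nat) :
  measurable_fun setT (fun x : n.-tuple R => \prod_(i < n) hipow (b i) (tnth x i)).
Proof.
apply: measurable_prod => i _; apply: measurableT_comp; last exact: measurable_tnth.
exact: measurable_hipow.
Qed.

Lemma measurable_dirichlet_fun n (b : 'I_n -> nat) l s :
  measurable_fun setT (dirichlet_fun b l s).
Proof.
apply: measurable_funM; first exact: measurable_prod_hipow.
apply: measurableT_comp; first exact: measurable_hipow.
apply: measurable_funB => //; exact: measurable_tsum.
Qed.

Lemma dirichlet_fun_cons n (b : 'I_n.+1 -> nat) l s t (y : n.-tuple R) :
  dirichlet_fun b l s (Defs.cons_tuple (t, y)) =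
  hipow (b ord0) t * dirichlet_fun (b \o lift ord0) l (s - t) y.
Proof.
rewrite /dirichlet_fun big_ord_recl tnth_cons0 tsum_cons -mulrA; congr (_ * (_ * _)).
  by apply: eq_bigr => i _; rewrite tnth_consS.
by rewrite opprD addrA.
Qed.

Lemma dirichlet0 (b : 'I_0 -> nat) l s : dirichlet b l s = (hipow l s)%:E.
Proof.
rewrite /dirichlet integral_dirac//; last first.
  by apply/measurable_EFinP; exact: measurable_dirichlet_fun.
by rewrite diracT mul1e /dirichlet_fun /tsum !big_ord0 mul1r subr0.
Qed.

Let mE n (b : 'I_n -> nat) l s : measurable_fun setT (EFin \o dirichlet_fun b l s).
Proof. by apply/measurable_EFinP; exact: measurable_dirichlet_fun. Qed.

Lemma dirichlet_cons1 n (b : 'I_n.+1 -> nat) l s : dirichlet b l s =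
  (\int[mu]_t ((hipow (b ord0) t)%:E * dirichlet (b \o lift ord0) l (s - t)))%E.
Proof.
rewrite /dirichlet integral_cons1; [|exact: mE|by move=> x; rewrite lee_fin dirichlet_fun_ge0].
apply: eq_integral => t _; rewrite -ge0_integralZl//; last 3 first.
- exact: mE.
- by move=> x _; rewrite lee_fin dirichlet_fun_ge0.
- by rewrite lee_fin hipow_ge0.
by apply: eq_integral => y _; rewrite dirichlet_fun_cons EFinM.
Qed.

Lemma dirichlet_cons2 n (b : 'I_n.+1 -> nat) l s : dirichlet b l s =
  (\int[lam n]_y ((\prod_(i < n) hipow (b (lift ord0 i)) (tnth y i))%:E *
     \int[mu]_t (hipow (b ord0) t * hipow l ((s - tsum y) - t))%:E))%E.
Proof.
rewrite /dirichlet integral_cons2; [|exact: mE|by move=> x; rewrite lee_fin dirichlet_fun_ge0].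
apply: eq_integral => y _; rewrite -ge0_integralZl//; last 3 first.
- by apply/measurable_EFinP; exact: measurable_hipow_conv.
- by move=> x _; rewrite lee_fin; apply: mulr_ge0; exact: hipow_ge0.
- by rewrite lee_fin prodr_ge0// => i _; exact: hipow_ge0.
apply: eq_integral => t _; rewrite dirichlet_fun_cons -EFinM; congr EFin.
by rewrite /dirichlet_fun mulrCA addrAC.
Qed.

Lemma measurable_dirichlet_cons n (b : 'I_n -> nat) k l s :
  measurable_fun setT (fun t : measurableTypeR R => (hipow k t)%:E * dirichlet b l (s - t))%E.
Proof.
pose b' (j : 'I_n.+1) := if unlift ord0 j is Some i then b i else k.
have := @measurable_int_cons1 n (EFin \o dirichlet_fun b' l s) (mE b' l s).
have f0 x : (0 <= (EFin \o dirichlet_fun b' l s) x)%E by rewrite lee_fin dirichlet_fun_ge0.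
move=> /(_ f0); apply: eq_measurable_fun => t _.
rewrite /dirichlet -ge0_integralZl//; last 3 first.
- exact: mE.
- by move=> x _; rewrite lee_fin dirichlet_fun_ge0.
- by rewrite lee_fin hipow_ge0.
apply: eq_integral => y _; rewrite /= dirichlet_fun_cons EFinM /b' unlift_none.
congr (_ * EFin (dirichlet_fun _ _ _ _))%E.
by apply/funext => i /=; rewrite liftK.
Qed.

Lemma dirichlet_ge0 n (b : 'I_n -> nat) l s : (0 <= dirichlet b l s)%E.
Proof. by apply: integral_ge0 => x _; rewrite lee_fin dirichlet_fun_ge0. Qed.

Lemma measurable_dirichlet_cons2 n (b : 'I_n -> nat) k l s :
  measurable_fun setT (fun y => (\prod_(i < n) hipow (b i) (tnth y i))%:E *
     \int[mu]_t (hipow k t * hipow l ((s - tsum y) - t))%:E)%E.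
Proof.
pose b' (j : 'I_n.+1) := if unlift ord0 j is Some i then b i else k.
have := @measurable_int_cons2 n (EFin \o dirichlet_fun b' l s) (mE b' l s).
have f0 x : (0 <= (EFin \o dirichlet_fun b' l s) x)%E by rewrite lee_fin dirichlet_fun_ge0.
move=> /(_ f0); apply: eq_measurable_fun => y _.
rewrite -ge0_integralZl//; last 3 first.
- by apply/measurable_EFinP; exact: measurable_hipow_conv.
- by move=> x _; rewrite lee_fin; apply: mulr_ge0; exact: hipow_ge0.
- by rewrite lee_fin prodr_ge0// => i _; exact: hipow_ge0.
apply: eq_integral => t _; rewrite /= dirichlet_fun_cons -EFinM; congr EFin.
rewrite /dirichlet_fun mulrCA addrAC /b' unlift_none; congr (_ * _).
by apply: eq_bigr => i _; rewrite /= liftK.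
Qed.

(** By induction on the dimension.  If [i] is not the first coordinate, integrate
    the others first, with [s - t] in place of [s]; if it is, integrate over it first,
    where the identity is one-dimensional. *)
Lemma dirichlet_by_parts n (b : 'I_n -> nat) i s :
  (dirichlet (fun j => b j + (j == i))%N 0 s =
   (2 * b i + 1)%:R%:E * dirichlet b 1 s)%E.
Proof.
elim: n => [|n IH] in b i s *; first by case: i.
have [j ->|->] := unliftP ord0 i.
  rewrite !dirichlet_cons1 -ge0_integralZl//; last 2 first.
  - exact: measurable_dirichlet_cons.
  - by move=> t _; rewrite mule_ge0 ?lee_fin ?hipow_ge0 ?dirichlet_ge0.
  apply: eq_integral => t _; rewrite muleCA; congr (_ * _)%E.
    by rewrite (negbTE (neq_lift _ _)) addn0.
  by rewrite -IH.
rewrite !dirichlet_cons2 -ge0_integralZl//; last 2 first.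
- exact: measurable_dirichlet_cons2.
- move=> y _; rewrite mule_ge0 ?lee_fin ?prodr_ge0// => [u _|]; first exact: hipow_ge0.
  by apply: integral_ge0 => t _; rewrite lee_fin; apply: mulr_ge0; exact: hipow_ge0.
apply: eq_integral => y _; rewrite muleCA -hipow_conv_by_parts eqxx addn1; congr (EFin _ * _)%E.
by apply: eq_bigr => u _; rewrite eq_sym (negbTE (neq_lift _ _)) addn0.
Qed.

End tonelli.

(** * Integrals and null sets *)

Section general_measure.
Context d (T : measurableType d) (R : realType) (m : {measure set T -> \bar R}).
Local Open Scope ereal_scope.

Lemma null_of_integral_eq0 (D : set T) (f : T -> \bar R) :
  measurable D -> measurable_fun setT f -> (forall x, 0 <= f x) ->
  \int[m]_x f x = 0 -> (forall x, D x -> f x != 0) -> m D = 0.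
Proof.
move=> mD mf f0 If fD.
have : ae_eq m setT f (cst 0).
  apply/(ae_eq_integral_abs m measurableT mf).
  by rewrite -If; apply: eq_integral => x _; rewrite gee0_abs.
move=> [N [mN N0 sub]]; apply: (subset_measure0 mD mN _ N0) => x Dx.
by apply: sub => /= /(_ I) fx; have := fD _ Dx; rewrite fx eqxx.
Qed.

Lemma integral_eq0_of_null (N : set T) (f : T -> \bar R) :
  measurable N -> m N = 0 -> measurable_fun setT f ->
  (forall x, ~ N x -> f x = 0) -> \int[m]_x f x = 0.
Proof.
move=> mN N0 mf f0.
rewrite (_ : \int[m]_x f x = \int[m]_x (cst 0) x); first by rewrite integral0.
apply: ae_eq_integral => //; exists N; split => // x /= fx.
by apply: contrapT => /f0 fx0; apply: fx.
Qed.

End general_measure.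

Section density.
Local Open Scope ereal_scope.
Context d (T : measurableType d) (R : realType).
Variables (mu : {measure set T -> \bar R}) (D : set T) (f : T -> R).
Hypotheses (mD : measurable D) (mf : measurable_fun D f).
Hypothesis f0 : forall x, D x -> (0 <= f x)%R.
Local Notation nu := (mdensity mu mD mf f0).

Import HBNNSimple.

Let mfE : measurable_fun D (EFin \o f).
Proof. exact/measurable_EFinP. Qed.

Let integral_mdensity_nnsfun (h : {nnsfun T >-> R}) :
  \int[nu]_x (h x)%:E = \int[mu]_(x in D) ((h x)%:E * (f x)%:E).
Proof.
rewrite integralT_nnsfun sintegralE.
under [RHS]eq_integral.
  move=> x xD; rewrite fimfunE -fsumEFin// ge0_mule_fsuml; last first.
    by move=> r; rewrite EFinM nnfun_muleindic_ge0.
  over.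
have m1 r : measurable_fun D (fun x => (\1_(h @^-1` [set r]) x : R)%:E * (f x)%:E).
  by apply: emeasurable_funM => //; apply/measurable_EFinP; exact: measurable_indic.
have ge r x : D x -> 0 <= (r * \1_(h @^-1` [set r]) x)%:E * (f x)%:E.
  by move=> Dx; rewrite mule_ge0 ?lee_fin ?f0// -lee_fin EFinM nnfun_muleindic_ge0.
rewrite ge0_integral_fsum//; last first.
  move=> r; under eq_fun do rewrite EFinM -muleA.
  exact: measurable_funeM.
apply: eq_fsbigr => r; rewrite inE => -[x _ <-].
under [RHS]eq_integral do rewrite EFinM -muleA.
rewrite ge0_integralZl//; last 2 first.
- by move=> y Dy; rewrite mule_ge0 ?lee_fin ?f0.
- by rewrite lee_fin.
congr (_ * _).
rewrite [LHS](_ : _ = \int[mu]_(y in (h @^-1` [set h x]) `&` D) (f y)%:E) //.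
rewrite setIC integral_mkcondr; apply: eq_integral => y yD.
by rewrite patchE indicE; case: ifPn => _; rewrite ?mul1e ?mul0e.
Qed.

Lemma ge0_integral_mdensity (h : T -> \bar R) : measurable_fun setT h ->
  (forall x, 0 <= h x) ->
  \int[nu]_x h x = \int[mu]_(x in D) (h x * (f x)%:E).
Proof.
move=> mh h0; pose h_ := nnsfun_approx measurableT mh.
transitivity (limn (fun n => \int[nu]_x (h_ n x)%:E)).
  rewrite -monotone_convergence//=.
  - apply: eq_integral => x _; apply/esym/cvg_lim => //=.
    by apply: cvg_nnsfun_approx => // y _; exact: h0.
  - by move=> n; apply: measurableT_comp => //; exact: measurable_funTS.
  - by move=> n x _; rewrite lee_fin.
  - by move=> x _ a b ab; rewrite lee_fin//; exact/lefP/nd_nnsfun_approx.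
under eq_fun do rewrite integral_mdensity_nnsfun.
rewrite -monotone_convergence//=.
- apply: eq_integral => x /[!inE] Dx; apply/cvg_lim => //=.
  apply: cvgeZr => //.
  by apply: cvg_nnsfun_approx => // y _; exact: h0.
- by move=> n; apply: emeasurable_funM => //; apply/measurable_EFinP; exact: measurable_funTS.
- by move=> n x Dx; rewrite mule_ge0// lee_fin// f0.
- move=> x Dx a b ab; apply: lee_wpmul2r; first by rewrite lee_fin f0.
  by rewrite lee_fin; exact/lefP/nd_nnsfun_approx.
Qed.

(** For [h] of any sign, because multiplication by a nonnegative density
    commutes with positive and negative parts. *)
Lemma integral_mdensity (h : T -> \bar R) : measurable_fun setT h ->
  \int[nu]_x h x = \int[mu]_(x in D) (h x * (f x)%:E).
Proof.
move=> mh; rewrite [LHS]integralE [RHS]integralE; congr (_ - _).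
  rewrite ge0_integral_mdensity//; last exact: measurable_funepos.
  by apply: eq_integral => x /[!inE] Dx; rewrite !funeposE maxe_pMl ?mul0e// lee_fin f0.
rewrite ge0_integral_mdensity//; last exact: measurable_funeneg.
apply: eq_integral => x /[!inE] Dx; rewrite !funenegE maxe_pMl ?mul0e ?lee_fin ?f0//.
by rewrite mulNe.
Qed.

End density.

(** * Size of the Dirichlet integrals *)

Section bounds.
Context {R : realType}.
Local Notation mu := (@lebesgue_measure R).
Local Notation lam := (@lebesgue_tuple R).

(** For [n = 0] this is an equality.  The bound [hipow 0 s], rather than a
    constant, is the shape that the induction reproduces: the convolution of [hipow 0] with
    itself is at most [4], and [1 <= hipow 0 s] when [0 < s <= 1]. *)
Lemma dirichlet_le n (s : R) : s <= 1 ->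
  (dirichlet (fun _ : 'I_n => 0%N) 0 s <= (4 ^+ n * hipow 0 s)%:E)%E.
Proof.
elim: n s => [|n IH] s s1; first by rewrite dirichlet0 expr0 mul1r.
rewrite dirichlet_cons1.
have m2 : measurable_fun setT (fun t => (hipow 0 t * hipow 0 (s - t))%:E).
  by apply/measurable_EFinP; exact: measurable_hipow_conv.
apply: (@le_trans _ _ (\int[mu]_t ((4 ^+ n)%:E * (hipow 0 t * hipow 0 (s - t))%:E))%E).
  apply: ge0_le_integral => //.
  - by move=> t _; rewrite mule_ge0 ?lee_fin ?hipow_ge0 ?dirichlet_ge0.
  - exact: measurable_dirichlet_cons.
  - exact: measurable_funeM.
  - move=> t _; have [t0|t0] := leP t 0.
      by rewrite hipow_npos// mul0r mul0e mule0.
    have st1 : s - t <= 1 by rewrite lerBlDr (le_trans s1)// lerDl ltW.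
    have H := IH _ st1.
    rewrite -EFinM mulrCA [leRHS]EFinM; apply: lee_wpmul2l => //.
    by rewrite lee_fin hipow_ge0.
rewrite ge0_integralZl//; last first.
- by move=> t _; rewrite lee_fin; apply: mulr_ge0; exact: hipow_ge0.
rewrite exprSr -mulrA EFinM; apply: lee_wpmul2l; first by rewrite lee_fin exprn_ge0.
have [s0|s0] := leP s 0.
  rewrite integral0_eq ?hipow_npos ?mulr0// => t _; rewrite hipow_conv_supp//= in_itv/=.
  by move=> /andP[]; lra.
apply: (le_trans (hipow_conv_le s)); rewrite lee_fin ler_peMr//.
rewrite /hipow expr0 div1r invf_ge1 ?sqrtr_gt0//.
by rewrite -sqrtr1 ler_wsqrtr.
Qed.

Lemma dirichlet_gt0 n (s : R) : 0 < s ->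
  (0 < dirichlet (fun _ : 'I_n => 0%N) 0 s)%E.
Proof.
elim: n s => [|n IH] s s0.
  by rewrite dirichlet0 lte_fin /hipow expr0 div1r invr_gt0 sqrtr_gt0.
rewrite lt_neqAle dirichlet_ge0 andbT eq_sym; apply/eqP; rewrite dirichlet_cons1 => H.
have P (t : R) : (0 <= (hipow 0 t)%:E * dirichlet (fun _ : 'I_n => 0%N) 0 (s - t))%E.
  by rewrite mule_ge0 ?lee_fin ?hipow_ge0 ?dirichlet_ge0.
have : mu `]0, s[%classic = 0%E.
  refine (@null_of_integral_eq0 _ (measurableTypeR R) R mu _ _ (measurable_itv _)
    (measurable_dirichlet_cons _ _ _ _) P H _).
  move=> t; rewrite /= in_itv/= => /andP[t0 ts].
  rewrite mule_neq0//; last by rewrite gt_eqF// IH// subr_gt0.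
  by rewrite gt_eqF// lte_fin /hipow expr0 div1r invr_gt0 sqrtr_gt0.
rewrite lebesgue_measure_itv/= lte_fin s0 sube0 => -[] s0'.
by rewrite s0' ltxx in s0.
Qed.
End bounds.

(** * Zero sets of polynomials *)

Section zero_set.
Context {R : realType}.
Local Notation mu := (@lebesgue_measure R).
Local Notation lam := (@lebesgue_tuple R).

Lemma pevalE n (p : mpoly n R) x :
  peval p x = \sum_(m <- msupp p) mcoeff m p * \prod_(i < n) tnth x i ^+ m i.
Proof. by rewrite /peval mevalE. Qed.

Lemma measurable_peval n (p : mpoly n R) : measurable_fun setT (peval p).
Proof.
rewrite (_ : peval p = fun x => \sum_(m <- msupp p) mcoeff m p * \prod_(i < n) tnth x i ^+ m i).
  apply: measurable_sum => m; apply: measurable_funM => //.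
  apply: measurable_prod => i _; apply: measurable_funX; exact: measurable_tnth.
by apply/funext => x; rewrite pevalE.
Qed.

Definition mnm_behead n (m : multinom n.+1) : multinom n :=
  Multinom [tuple m (lift ord0 i) | i < n].

Lemma mnm_beheadE n (m : multinom n.+1) i : mnm_behead m i = m (lift ord0 i).
Proof. by rewrite mnmE. Qed.

(** The coefficient of the k-th power of the first variable, as a polynomial in
    the others. *)
Definition slice n (p : mpoly n.+1 R) (k : nat) : mpoly n R :=
  \sum_(m <- msupp p | m ord0 == k) mcoeff m p *: mpolyX R (mnm_behead m).

Lemma slice_neq0 n (p : mpoly n.+1 R) : p != 0 ->
  exists2 k, slice p k != 0 & (k < mmeasure mdeg p)%N.
Proof.
move=> p0; have [m mp] : exists m, m \in msupp p.
  case E : (msupp p) => [|m s]; last by exists m; rewrite inE eqxx.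
  by move: p0; rewrite -msupp_eq0 E.
exists (m ord0); last first.
  apply: leq_ltn_trans (mmeasure_mnm_lt mdeg mp).
  exact: mnm_le_mdeg.
apply/eqP => /(congr1 (mcoeff (mnm_behead m))); rewrite mcoeff0 /slice raddf_sum /=.
rewrite -big_filter (bigD1_seq m) /=; last 2 first.
- by rewrite mem_filter eqxx.
- by rewrite filter_uniq// msupp_uniq.
rewrite mcoeffZ mcoeffX eqxx mulr1 big_seq_cond big1 ?addr0.
  by apply/eqP; rewrite -mcoeff_msupp.
move=> m' /andP[]; rewrite mem_filter => /andP[/eqP m0 _] mm'.
rewrite mcoeffZ mcoeffX; case: eqP => [E|_]; last by rewrite mulr0.
case/eqP: mm'; apply/mnmP => i; have [j ->|->//] := unliftP ord0 i.
by rewrite -!mnm_beheadE E.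
Qed.

Lemma peval_cons n (p : mpoly n.+1 R) t y :
  peval p (Defs.cons_tuple (t, y)) =
  (\poly_(k < mmeasure mdeg p) peval (slice p k) y).[t].
Proof.
rewrite horner_poly pevalE.
transitivity (\sum_(k < mmeasure mdeg p) \sum_(m <- msupp p | m ord0 == k)
  mcoeff m p * \prod_(i < n.+1) tnth (Defs.cons_tuple (t, y)) i ^+ m i).
  rewrite (exchange_big_dep predT)//= big_seq [RHS]big_seq; apply: eq_bigr => m mp.
  have mlt : (m ord0 < mmeasure mdeg p)%N.
    apply: leq_ltn_trans (mmeasure_mnm_lt mdeg mp).
    exact: mnm_le_mdeg.
  rewrite (bigD1 (Ordinal mlt))//= [X in _ + X]big1 ?addr0// => i /andP[/eqP mi].
  by case/eqP; apply/val_inj.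
apply: eq_bigr => k _; rewrite /peval /slice raddf_sum /= mulr_suml.
apply: eq_bigr => m /eqP mk; rewrite mevalZ mevalX -mulrA; congr (_ * _).
rewrite big_ord_recl tnth_cons0 mk mulrC; congr (_ * _).
by apply: eq_bigr => i _; rewrite tnth_consS mnm_beheadE.
Qed.

Lemma finite_roots (q : {poly R}) : q != 0 -> finite_set [set t | root q t].
Proof.
move=> q0; apply: contrapT => inf.
have [A sub sA] := infinite_set_fset (size q) inf.
have : (size (finmap.enum_fset A) < size q)%N.
  apply: (max_poly_roots q0); last exact: finmap.fset_uniq.
  by apply/allP => t tA; exact: sub.
by rewrite ltnNge sA.
Qed.

(** By induction on the number of variables: outside the zero set of a nonzero
    coefficient [slice p k], which is null, [p] is a nonzero polynomial in its first variable
    and has finitely many roots. *)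
Lemma null_zero_set n (p : mpoly n R) : p != 0 ->
  lam n [set x | peval p x = 0] = 0%E.
Proof.
have mZ k (q : mpoly k R) : measurable [set x | peval q x = 0].
  by rewrite -[X in measurable X]setTI; exact: (measurable_peval q measurableT (measurable_set1 0)).
elim: n p => [|n IH] p p0.
  suff -> : [set x | peval p x = 0] = set0 by rewrite measure0.
  apply/seteqP; split=> // x /= px; case/eqP: p0.
  have pC : p = mpolyC 0 (mcoeff (@mnm0 0) p).
    apply/mpolyP => m; rewrite mcoeffC (_ : m = @mnm0 0) ?eqxx ?mulr1//.
    by apply/mnmP => -[].
  by move: px; rewrite pC /peval mevalC => ->; rewrite mpolyC0.
have mi : measurable_fun setT (fun x => (\1_[set x | peval p x = 0] x : R)%:E).
  by apply/measurable_EFinP; apply: measurable_indic; exact: mZ.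
have -> : lam n.+1 [set x | peval p x = 0] =
    (\int[lam n.+1]_x (\1_[set x | peval p x = 0%R] x)%:E)%E.
  by rewrite integral_indic ?setIT//; exact: mZ.
rewrite integral_cons2//; have [k sk kp] := slice_neq0 p0.
apply: (@integral_eq0_of_null _ _ _ _ [set y | peval (slice p k) y = 0]).
- exact: mZ.
- exact: IH.
- exact: (@measurable_int_cons2 _ _ _ mi).
move=> y yk.
rewrite (_ : (fun t => _) = (fun t =>
    (\1_[set t | root (\poly_(k < mmeasure mdeg p) peval (slice p k) y) t] t)%:E)); last first.
  apply/funext => t; rewrite !indicE; congr ((nat_of_bool _)%:R%:E).
  apply/idP/idP; rewrite !inE /= peval_cons => H; first exact/rootP.
  exact/rootP.
have fr : finite_set [set t | root (\poly_(k < mmeasure mdeg p) peval (slice p k) y) t].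
  apply: finite_roots; apply/eqP => /polyP/(_ k).
  by rewrite coef_poly kp coef0.
rewrite integral_indic// ?setIT.
  exact/countable_lebesgue_measure0/finite_set_countable.
exact/countable_measurable/finite_set_countable.
Qed.

End zero_set.

(** * Integration of polynomials against the equilibrium measure *)

Section equilibrium_form.
Context (R : realType) (d : nat).
Local Notation lam := (@lebesgue_tuple R d).
Local Notation poly := (mpoly d R).
Local Notation monom m := (mpolyX R m).
Local Notation "'X_ i" := (mpolyX R (mnm1 i)) (at level 8, i at level 2).
Implicit Types (f p q : poly) (e : d.+1.-tuple bool).

Lemma eqweightE (x : d.-tuple R) : eqweight x = dirichlet_fun (fun=> 0%N) 0 1 x.
Proof.
rewrite /eqweight /dirichlet_fun invfM -prodfV; congr (_ * _); last by rewrite /hipow expr0 div1r.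
by apply: eq_bigr => i _; rewrite /hipow expr0 div1r.
Qed.

(** The weight vanishes off the simplex by the conventions for square roots and
    inverses, so integrals over the simplex can be taken over the whole space. *)
Lemma eqweight_supp (x : d.-tuple R) : ~ simplex x -> eqweight x = 0.
Proof.
move=> xD; rewrite eqweightE /dirichlet_fun.
have [/forallP x0|] := boolP [forall i, 0 <= tnth x i]; last first.
  rewrite negb_forall => /existsP[i]; rewrite -ltNge => /ltW xi.
  by rewrite (bigD1 i)//= hipow_npos// !mul0r.
rewrite (hipow_npos 0 (t := 1 - _)) ?mulr0// subr_le0 leNgt; apply/negP => /ltW x1.
by apply: xD; split.
Qed.

(** The total mass of the unnormalized weight, as a real number. *)
Definition eqmass : R := fine (dirichlet (fun _ : 'I_d => 0%N) 0 (1 : R)).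

Lemma dirichlet_funE (b : 'I_d -> nat) l (x : d.-tuple R) :
  dirichlet_fun b l 1 x =
  (\prod_(i < d) tnth x i ^+ b i * (1 - tsum x) ^+ l) * eqweight x.
Proof.
rewrite eqweightE /dirichlet_fun mulrACA -big_split /=; congr (_ * _).
  by apply: eq_bigr => i _; rewrite /hipow expr0 div1r.
by rewrite /hipow expr0 div1r.
Qed.

Lemma simplex_bounds (x : d.-tuple R) : simplex x ->
  (forall i, 0 <= tnth x i <= 1) /\ 0 <= 1 - tsum x <= 1.
Proof.
move=> [x0 x1]; have sx0 (P : pred 'I_d) : 0 <= \sum_(i < d | P i) tnth x i.
  by apply: sumr_ge0 => i _.
split=> [i|]; last by rewrite subr_ge0 x1 lerBlDr lerDl sx0.
rewrite x0; apply: le_trans x1; rewrite /tsum (bigD1 i)//= lerDl.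
exact: sx0.
Qed.

Lemma dirichlet_fun_le (b : 'I_d -> nat) l (x : d.-tuple R) :
  dirichlet_fun b l 1 x <= eqweight x.
Proof.
rewrite dirichlet_funE; have [xD|xD] := pselect (simplex x); last first.
  by rewrite eqweight_supp// mulr0.
rewrite ler_piMl ?eqweight_ge0//; have [x01 /andP[s0 s1]] := simplex_bounds xD.
apply: mulr_ile1; rewrite ?exprn_ge0 ?exprn_ile1//.
  by apply: prodr_ge0 => i _; have /andP[? _] := x01 i; exact: exprn_ge0.
apply: prodr_ile1 => i _; have /andP[xi0 xi1] := x01 i.
by rewrite exprn_ge0 ?exprn_ile1.
Qed.

Let mdf (b : 'I_d -> nat) l s : measurable_fun setT (fun x : d.-tuple R => (dirichlet_fun b l s x)%:E).
Proof. by apply/measurable_EFinP; exact: measurable_dirichlet_fun. Qed.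

Lemma dirichlet_fin (b : 'I_d -> nat) l : (dirichlet b l (1 : R)) \is a fin_num.
Proof.
rewrite ge0_fin_numE ?dirichlet_ge0//.
apply: (@le_lt_trans _ _ (dirichlet (fun _ : 'I_d => 0%N) 0 (1 : R))); last first.
  by apply: (le_lt_trans (dirichlet_le d (lexx 1))); rewrite ltry.
apply: ge0_le_integral => //.
- by move=> x _; rewrite lee_fin dirichlet_fun_ge0.
by move=> x _; rewrite lee_fin -eqweightE dirichlet_fun_le.
Qed.

Lemma eqmass_gt0 : 0 < eqmass.
Proof. by apply: fine_gt0; rewrite dirichlet_gt0//= -ge0_fin_numE ?dirichlet_fin ?dirichlet_ge0. Qed.

Lemma eqmassE : (\int[lam]_(x in @simplex R d) (eqweight x)%:E = eqmass%:E)%E.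
Proof.
rewrite fineK ?dirichlet_fin// integral_mkcond; apply: eq_integral => x _.
rewrite -eqweightE patchE; case: ifPn => // /negP; rewrite inE => xD.
by rewrite eqweight_supp.
Qed.

Definition eqdens (x : d.-tuple R) : R := eqmass^-1 * eqweight x.

Lemma eqdens_ge0 x : 0 <= eqdens x.
Proof.
apply: mulr_ge0; first by rewrite invr_ge0 ltW// eqmass_gt0.
by rewrite eqweightE dirichlet_fun_ge0.
Qed.

Lemma measurable_eqdens : measurable_fun setT eqdens.
Proof.
apply: measurable_funM => //; rewrite (_ : @eqweight R d = dirichlet_fun (fun=> 0%N) 0 1).
  exact: measurable_dirichlet_fun.
by apply/funext => x; rewrite eqweightE.
Qed.

Lemma eqdens_supp x : ~ simplex x -> eqdens x = 0.
Proof. by move=> xD; rewrite /eqdens eqweight_supp ?mulr0. Qed.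

(** The normalization is itself a density with respect to Lebesgue measure,
    so that [integral_mdensity] applies to functions of any sign. *)
Lemma integral_equilibrium (h : d.-tuple R -> R) : measurable_fun setT h ->
  (\int[equilibrium R d]_x (h x)%:E = \int[lam]_x (h x * eqdens x)%:E)%E.
Proof.
move=> mh; have mhE : measurable_fun setT (EFin \o h) by exact/measurable_EFinP.
have mD := @measurable_simplex R d.
have md : measurable_fun (@simplex R d) eqdens by apply: measurable_funTS; exact: measurable_eqdens.
have d0 x : simplex x -> 0 <= eqdens x by move=> _; exact: eqdens_ge0.
rewrite (@eq_measure_integral _ _ _ _ (mdensity lam mD md d0)).
  rewrite integral_mdensity// integral_mkcond; apply: eq_integral => x _.
  rewrite patchE; case: ifPn => // /negP; rewrite inE => xD.
  by rewrite eqdens_supp// mulr0.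
move=> A mA _.
have massE : (mdensity lam mD (@measurable_eqweight R d) (@eqweight_ge0 R d)
    : {measure set (d.-tuple R) -> \bar R}) setT = eqmass%:E.
  rewrite -eqmassE [LHS](_ : _ =
    \int[lam]_(x in setT `&` @simplex R d) (eqweight x)%:E)%E //.
  by rewrite setTI.
have mass0 : (eqmass%:E == 0)%E = false by rewrite eqe gt_eqF// eqmass_gt0.
rewrite /equilibrium /= /mnormalize massE mass0 /=.
rewrite /mdensity muleC -ge0_integralZl//.
- exact: measurableI.
- have mw : measurable_fun (@simplex R d) (fun x => (eqweight x)%:E).
    by apply/measurable_EFinP; exact: measurable_eqweight.
  by apply: (measurable_funS mD _ mw) => x [].
- by move=> x [_ Dx]; rewrite lee_fin eqweight_ge0.
- by rewrite lee_fin invr_ge0 ltW// eqmass_gt0.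
Qed.

(** The last barycentric coordinate, the square of [u_(d+1)] on the sphere. *)
Definition last_coord : poly := 1 - \sum_(i < d) 'X_i.

Lemma pevalD p q x : peval (p + q) x = peval p x + peval q x.
Proof. exact: mevalD. Qed.
Lemma pevalM p q x : peval (p * q) x = peval p x * peval q x.
Proof. exact: mevalM. Qed.
Lemma pevalZ c p x : peval (c *: p) x = c * peval p x.
Proof. exact: mevalZ. Qed.
Lemma peval_sum I (r : seq I) (P : pred I) (F : I -> poly) x :
  peval (\sum_(i <- r | P i) F i) x = \sum_(i <- r | P i) peval (F i) x.
Proof. exact: raddf_sum. Qed.
Lemma pevalX m x : peval (monom m : poly) x = \prod_(i < d) tnth x i ^+ m i.
Proof. exact: mevalX. Qed.
Lemma pevalXU i x : peval ('X_i : poly) x = tnth x i.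
Proof. exact: mevalXU. Qed.

Lemma peval_last_coord x : peval last_coord x = 1 - tsum x.
Proof.
rewrite /last_coord /peval mevalB meval1; congr (_ - _).
by rewrite raddf_sum; apply: eq_bigr => i _; exact: mevalXU.
Qed.

Definition eqint p : R := \int[lam]_x (peval p x * eqdens x).

Lemma peval_moment m l x :
  peval (last_coord ^+ l * monom m) x * eqdens x =
  eqmass^-1 * dirichlet_fun m l 1 x.
Proof.
rewrite pevalM pevalX /peval rmorphXn /= -/(peval _ _) peval_last_coord.
by rewrite dirichlet_funE /eqdens mulrCA [_ ^+ l * _]mulrC.
Qed.

Lemma integrable_moment m l :
  lam.-integrable setT (fun x => (peval (last_coord ^+ l * monom m) x * eqdens x)%:E).
Proof.
apply/integrableP; split.
  apply/measurable_EFinP; apply: measurable_funM; first exact: measurable_peval.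
  exact: measurable_eqdens.
under eq_integral => x _.
  rewrite peval_moment gee0_abs; last first.
    by rewrite lee_fin mulr_ge0 ?dirichlet_fun_ge0// invr_ge0 ltW// eqmass_gt0.
  rewrite EFinM.
  over.
rewrite ge0_integralZl//; last 2 first.
- by move=> x _; rewrite lee_fin dirichlet_fun_ge0.
- by rewrite lee_fin invr_ge0 ltW// eqmass_gt0.
rewrite -ge0_fin_numE; first by rewrite fin_numM// dirichlet_fin.
by rewrite mule_ge0 ?dirichlet_ge0// lee_fin invr_ge0 ltW// eqmass_gt0.
Qed.

Lemma eqint_moment m l :
  eqint (last_coord ^+ l * monom m) = eqmass^-1 * fine (dirichlet m l (1 : R)).
Proof.
rewrite /eqint /Rintegral; under eq_integral do rewrite peval_moment EFinM.
rewrite ge0_integralZl//; last 2 first.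
- by move=> x _; rewrite lee_fin dirichlet_fun_ge0.
- by rewrite lee_fin invr_ge0 ltW// eqmass_gt0.
by rewrite fineM// dirichlet_fin.
Qed.

Lemma integrable_eqint p : lam.-integrable setT (fun x => (peval p x * eqdens x)%:E).
Proof.
elim/mpolyind: p => [|c m p _ _ ih].
  under eq_fun do rewrite /peval meval0 mul0r.
  exact: integrable0.
rewrite (_ : (fun x => _) = ((fun x => c%:E * (peval (last_coord ^+ 0 * monom m) x * eqdens x)%:E) \+
  (fun x => (peval p x * eqdens x)%:E))%E).
  by apply: integrableD => //; apply: integrableZl => //; exact: integrable_moment.
by apply/funext => x /=; rewrite pevalD pevalZ mulrDl EFinD expr0 mul1r -mulrA EFinM.
Qed.

Lemma eqint_is_scalar : scalar eqint.
Proof.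
move=> c p q; rewrite /eqint -RintegralZl//; last exact: integrable_eqint.
rewrite -RintegralD//; last 2 first.
- have := integrableZl measurableT c (integrable_eqint p).
  by under eq_fun do rewrite -EFinM.
- exact: integrable_eqint.
by apply: eq_Rintegral => x _; rewrite pevalD pevalZ mulrDl mulrA.
Qed.

HB.instance Definition _ := GRing.isLinear.Build R poly R *%R eqint eqint_is_scalar.

Lemma eqint1 : eqint 1 = 1.
Proof.
have := eqint_moment (@mnm0 d) 0; rewrite mpolyX0 mulr1 expr0 => ->.
rewrite (_ : dirichlet _ _ _ = dirichlet (fun _ : 'I_d => 0%N) 0 (1 : R)); last first.
  by congr dirichlet; apply/funext => i; exact: mnm0E.
by rewrite mulVf// gt_eqF// eqmass_gt0.
Qed.

Lemma mulX_mderivX i (m : multinom d) :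
  'X_i * mderiv i (monom m) = (m i)%:R *: monom m :> poly.
Proof.
rewrite mderivX -scalerAr -mpolyXD; case: (posnP (m i)) => [->|mi]; first by rewrite !scale0r.
congr (_ *: mpolyX R _); apply/mnmP => j; rewrite mnmDE mnmBE mnm1E.
by case: eqP => [<-|_]; rewrite ?subn0// subnKC.
Qed.

(** Invariance of the measure under rotations: with [x_i = u_i^2], the argument
    of [eqint] is [D_i (u_i u_(d+1) f)] for the field [D_i = u_i d_(d+1) - u_(d+1) d_i]
    on the sphere.  On a monomial it is [dirichlet_by_parts]. *)
Lemma eqint_by_parts i f :
  eqint (('X_i - last_coord) * f - 2 *: ('X_i * last_coord * mderiv i f)) = 0.
Proof.
elim/mpolyind: f => [|c m p _ _ ih]; first by rewrite raddf0 !mulr0 scaler0 subr0 raddf0.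
set T := (X in eqint X).
have -> : T = c *: (('X_i - last_coord) * monom m - 2 *: ('X_i * last_coord * mderiv i (monom m)))
   + (('X_i - last_coord) * p - 2 *: ('X_i * last_coord * mderiv i p)).
  by rewrite /T mderivD mderivZ -!mul_mpolyC; ring.
rewrite eqint_is_scalar ih addr0 mulrAC mulX_mderivX.
have -> : ('X_i - last_coord) * monom m - 2 *: ((m i)%:R *: monom m * last_coord) =
  last_coord ^+ 0 * monom (mnm_add (mnm1 i) m) - (2 * m i + 1)%:R *: (last_coord ^+ 1 * monom m).
  by rewrite expr0 expr1 mpolyXD -!mul_mpolyC natrD natrM (mpolyCD _ (2%:R * (m i)%:R)) mpolyCM mpolyC1; ring.
rewrite linearB linearZ /= !eqint_moment.
rewrite (_ : dirichlet (mnm_add _ _) _ _ = ((2 * m i + 1)%:R%:E * dirichlet m 1 (1 : R))%E).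
  by rewrite fineM//= ?dirichlet_fin//; ring.
rewrite -dirichlet_by_parts; congr dirichlet; apply/funext => j.
by rewrite mnmDE mnm1E addnC eq_sym.
Qed.

Definition gpoly e : poly :=
  (\prod_(i < d) 'X_i ^+ tnth e (widen_ord (leqnSn d) i)) * last_coord ^+ tnth e ord_max.

Lemma peval_gpoly e x : peval (gpoly e) x = gfun e x.
Proof.
rewrite pevalM /gfun; congr (_ * _).
  rewrite /peval rmorph_prod; apply: eq_bigr => i _.
  by rewrite rmorphXn /=; congr (_ ^+ _); exact: pevalXU.
by rewrite /peval rmorphXn /=; congr (_ ^+ _); exact: peval_last_coord.
Qed.

Lemma peval_gpolyM e p q x :
  peval (gpoly e * p * q) x = gfun e x * peval p x * peval q x.
Proof. by rewrite (pevalM (gpoly e * p)) (pevalM (gpoly e)) peval_gpoly. Qed.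

Lemma gpoly_neq0 e : gpoly e != 0.
Proof.
rewrite mulf_neq0// ?expf_neq0//.
  apply/prodf_neq0 => i _; rewrite expf_neq0//.
  by apply/eqP => /(congr1 (mcoeff (mnm1 i))) /eqP; rewrite mcoeffX eqxx mcoeff0 oner_eq0.
apply/eqP => /(congr1 (fun p => peval p [tuple of nseq d 0])) /eqP.
rewrite peval_last_coord /tsum big1 ?subr0; first by rewrite /peval meval0 oner_eq0.
by move=> i _; rewrite tnth_nseq.
Qed.

Lemma pdot_gequilibrium e p q :
  pdot (gequilibrium R e) p q = eqint (gpoly e * p * q).
Proof.
have mD := @measurable_simplex R d.
rewrite /pdot /eqint /Rintegral; congr fine.
have mpq : measurable_fun setT (fun x : d.-tuple R => peval p x * peval q x).
  by apply: measurable_funM; exact: measurable_peval.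
rewrite /gequilibrium integral_mdensity; last exact/measurable_EFinP.
pose h (x : d.-tuple R) := (peval p x * peval q x) * gfun e x * \1_(@simplex R d) x.
have mh : measurable_fun setT h.
  apply: measurable_funM; last exact: measurable_indic.
  apply: measurable_funM => //; rewrite (_ : gfun e = peval (gpoly e)).
    exact: measurable_peval.
  by apply/funext => x; rewrite peval_gpoly.
rewrite integral_mkcond (_ : (_ \_ _) = EFin \o h); last first.
  apply/funext => x /=; rewrite patchE /h indicE; case: ifPn => xD.
    by rewrite mulr1.
  by rewrite mulr0.
rewrite integral_equilibrium//; apply: eq_integral => x _; congr EFin.
rewrite peval_gpolyM /h indicE; have [xD|xD] := pselect (simplex x).
  by rewrite mem_set// mulr1; congr (_ * _); ring.
by rewrite eqdens_supp// !mulr0.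
Qed.

(** The integrand is nonnegative.  If its integral vanished, the density would be
    supported, up to a null set, on the zero set of a nonzero polynomial, which is null; but
    the density has integral [1]. *)
Lemma eqint_gt0 e q : q != 0 -> 0 < eqint (gpoly e * q * q).
Proof.
move=> q0; have mD := @measurable_simplex R d.
have ge0 x : 0 <= peval (gpoly e * q * q) x * eqdens x.
  have [xD|xD] := pselect (simplex x); last by rewrite eqdens_supp// mulr0.
  rewrite mulr_ge0 ?eqdens_ge0// peval_gpolyM -mulrA -expr2.
  by rewrite mulr_ge0 ?sqr_ge0// gfun_ge0.
rewrite lt_neqAle eq_sym /eqint Rintegral_ge0 ?andbT; last by move=> x _.
apply/eqP => I0; pose s := fun x : d.-tuple R => (peval (gpoly e * q * q) x * eqdens x)%:E.
have ms : measurable_fun setT s by have /integrableP[] := integrable_eqint (gpoly e * q * q).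
have {}I0 : (\int[lam]_x s x = 0)%E.
  by rewrite -[LHS]fineK ?[fine _]I0//; apply: integrable_fin_num => //; exact: integrable_eqint.
pose P := [set x | peval (gpoly e * q * q) x = 0].
(* On N the integrand is nonzero, and the density vanishes off the union of N and P. *)
pose N := [set x | eqdens x != 0 :> R] `\` P.
have mP : measurable P.
  rewrite -[X in measurable X]setTI.
  exact: (measurable_peval (gpoly e * q * q) measurableT (measurable_set1 0)).
have mE : measurable [set x : d.-tuple R | eqdens x != 0].
  rewrite (_ : mkset _ = ~` [set x | eqdens x = 0]).
    apply: measurableC; rewrite -[X in measurable X]setTI.
    exact: (measurable_eqdens measurableT (measurable_set1 0)).
  by apply/seteqP; split=> x /= /eqP.
have mN : measurable N by exact: measurableD.
have N0 : lam N = 0%E.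
  apply: (null_of_integral_eq0 mN ms _ I0); first by move=> x; rewrite lee_fin.
  by move=> x [/= x1 x2]; rewrite /s eqe mulf_neq0//; exact/eqP.
have P0 : lam P = 0%E.
  by apply: null_zero_set; apply: mulf_neq0 => //; apply: mulf_neq0 => //; exact: gpoly_neq0.
have := eqint1; rewrite /eqint /Rintegral (@integral_eq0_of_null _ _ _ _ (N `|` P)) /=.
- by move/eqP; rewrite eq_sym oner_eq0.
- exact: measurableU.
- apply/eqP; rewrite -measure_le0; apply: (le_trans (measureU2 _ mN mP)).
  by rewrite [X in (_ + X <= _)%E]P0 [X in (X + _ <= _)%E]N0 adde0.
- by have /integrableP[] := integrable_eqint (1 : poly).
move=> x NP; have [xE|xE] := eqVneq (eqdens x) 0; first by rewrite xE mulr0.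
by exfalso; apply: NP; have [xP|xP] := pselect (P x); [right|left].
Qed.

End equilibrium_form.

(** * Orthonormal bases, kernels and the Christoffel function *)

Section ortho.
Context (R : realType) (d : nat) (nu : {measure set (d.-tuple R) -> \bar R}).
Local Notation poly := (mpoly d R).
Local Notation B := (pdot nu).
Local Notation msize p := (mmeasure mdeg p).
Implicit Types (p q : poly) (a b : multinom d) (s : seq (multinom d)).

Hypothesis Blin : forall q, scalar (fun p : poly => B p q).
Hypothesis Bpos : forall p, p != 0 -> 0 < B p p.

Lemma pdotC p q : B p q = B q p.
Proof. by rewrite /pdot; apply: eq_Rintegral => x _; rewrite mulrC. Qed.

Let pdot0l q : B 0 q = 0.
Proof. by have /= := Blin q (-1) 0 0; rewrite scaler0 addr0 mulN1r addNr. Qed.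

Let pdotDl p p' q : B (p + p') q = B p q + B p' q.
Proof. by have /= := Blin q 1 p p'; rewrite scale1r mul1r. Qed.

Let pdotZl c p q : B (c *: p) q = c * B p q.
Proof. by have /= := Blin q c p 0; rewrite pdot0l !addr0. Qed.

Lemma pdot_suml I (r : seq I) (P : pred I) (F : I -> poly) q :
  B (\sum_(i <- r | P i) F i) q = \sum_(i <- r | P i) B (F i) q.
Proof. by apply: (big_morph (fun p => B p q)); [move=> ? ?; exact: pdotDl|exact: pdot0l]. Qed.

Let pdotBl p p' q : B (p - p') q = B p q - B p' q.
Proof. by rewrite pdotDl -scaleN1r pdotZl mulN1r. Qed.

Let pdot_eq0 p : B p p = 0 -> p = 0.
Proof. by move=> p0; apply/eqP; apply: contraT => /Bpos; rewrite p0 ltxx. Qed.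

(** Orthonormalization of the monomials in [s], taken in order of degree, where
    [F a] replaces the monomial of exponent [a].  The last clause, for all [k] at once, says
    that the polynomials of degree less than [k] are spanned by the [F b] of degree less than
    [k]; this is where the ordering by degree matters. *)
Lemma gram_schmidt s : uniq s -> pairwise (fun a b => mdeg a <= mdeg b)%N s ->
  exists F : multinom d -> poly,
  [/\ {in s &, forall a b, B (F a) (F b) = (a == b)%:R},
      {in s, forall a b, mcoeff b (F a) != 0 -> b \in s /\ (mdeg b <= mdeg a)%N}
    & forall k p, (forall b, mcoeff b p != 0 -> b \in s /\ (mdeg b < k)%N) ->
        p = \sum_(b <- s | (mdeg b < k)%N) B p (F b) *: F b].
Proof.
elim/last_ind: s => [_ _|s z IH].
  exists (fun=> 0); split=> // k p pk; rewrite big_nil; apply/mpolyP => m.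
  by rewrite mcoeff0; apply/eqP; apply: contraT => /pk[].
rewrite rcons_uniq pairwise_rcons => /andP[zs us] /andP[/allP /= sz ps].
have [F [Fo Fs Fp]] := IH us ps.
pose X : poly := mpolyX R z.
pose r := X - \sum_(b <- s) B X (F b) *: F b.
have rF b : b \in s -> B r (F b) = 0.
  move=> bs; rewrite /r pdotBl pdot_suml (bigD1_seq b)//= pdotZl Fo// eqxx mulr1.
  rewrite big_seq_cond big1 ?addr0 ?subrr// => b' /andP[b's b'b].
  by rewrite pdotZl Fo// (negbTE b'b) mulr0.
have Fz b : b \in s -> mcoeff z (F b) = 0.
  by move=> bs; apply/eqP; apply: contraT => /(Fs _ bs)[]; rewrite (negbTE zs).
(* The earlier F b do not involve the monomial z, so r is nonzero. *)
have rz : mcoeff z r = 1.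
  rewrite /r mcoeffB mcoeffX eqxx raddf_sum /= big_seq big1 ?subr0// => b bs.
  by rewrite mcoeffZ Fz// mulr0.
have r0 : r != 0 by apply/eqP => r0; move: rz; rewrite r0 mcoeff0 => /esym/eqP; rewrite oner_eq0.
pose n := Num.sqrt (B r r).
have n0 : n != 0 by rewrite gt_eqF// sqrtr_gt0 Bpos.
have nn : n * n = B r r by rewrite -expr2 sqr_sqrtr// ltW// Bpos.
pose g := n^-1 *: r.
have gg : B g g = 1.
  by rewrite /g pdotZl pdotC pdotZl -nn mulKf// mulVf.
have gF b : b \in s -> B g (F b) = 0 by move=> bs; rewrite /g pdotZl rF// mulr0.
pose F' a := if a == z then g else F a.
have F'z : F' z = g by rewrite /F' eqxx.
have F's b : b \in s -> F' b = F b.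
  by move=> bs; rewrite /F'; case: eqP => // bz; rewrite bz (negbTE zs) in bs.
have sne b : b \in s -> (b == z) = false.
  by move=> bs; apply/eqP => bz; rewrite bz (negbTE zs) in bs.
exists F'; split.
- move=> a b; rewrite !mem_rcons !inE => /orP[/eqP->|as_] /orP[/eqP->|bs].
  + by rewrite F'z eqxx.
  + by rewrite F'z F's// gF// eq_sym sne.
  + by rewrite F'z F's// pdotC gF// sne.
  + by rewrite !F's// Fo.
- move=> a; rewrite mem_rcons inE => /orP[/eqP->|as_] b.
    rewrite F'z /g mcoeffZ mulf_eq0 invr_eq0 (negbTE n0)/= /r mcoeffB mcoeffX.
    have [<- _|zb] := eqVneq z b; first by rewrite mem_rcons inE eqxx.
    rewrite sub0r oppr_eq0 raddf_sum /= => H.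
    have [b' b's Hb'] : exists2 b', b' \in s & mcoeff b (F b') != 0.
      apply: contrapT => nb; case/eqP: H; rewrite big_seq big1// => b' b's.
      rewrite mcoeffZ (_ : mcoeff b _ = 0) ?mulr0//; apply/eqP; apply: contrapT => /negP Hb.
      by apply: nb; exists b'.
    have [bs bb'] := Fs _ b's _ Hb'.
    by rewrite mem_rcons inE bs orbT; split => //; apply: leq_trans bb' (sz _ b's).
  rewrite F's// => /(Fs _ as_)[bs ba]; by rewrite mem_rcons inE bs orbT.
move=> k p pk; rewrite -cats1 big_cat /= [X in _ + X]big_cons big_nil.
have [zk|zk] := ltnP (mdeg z) k; rewrite addr0; last first.
  rewrite {1}(Fp k p); last first.
    move=> b /pk[]; rewrite mem_rcons inE => /orP[/eqP ->|//].
    by rewrite ltnNge zk.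
  rewrite big_seq_cond [RHS]big_seq_cond; apply: eq_bigr => b /andP[bs _].
  by rewrite F's.
have sk b : b \in s -> (mdeg b < k)%N by move=> /sz /leq_ltn_trans; apply.
have cond (G : multinom d -> poly) :
    \sum_(b <- s | (mdeg b < k)%N) G b = \sum_(b <- s) G b.
  rewrite big_seq_cond [RHS]big_seq; apply: eq_bigl => b.
  by case: (boolP (b \in s)) => //= /sk ->.
rewrite cond.
(* E q, that q is the sum of its projections, is stable under linear combinations. *)
pose E q := q = \sum_(b <- s) B q (F' b) *: F' b + B q (F' z) *: F' z.
have Elin c q q' : E q -> E q' -> E (c *: q + q').
  rewrite /E => Eq Eq'; rewrite {1}Eq {1}Eq' scalerDr addrACA scaler_sumr -big_split /=.
  rewrite Blin scalerDl scalerA; congr (_ + _); apply: eq_bigr => b _.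
  by rewrite Blin scalerDl scalerA.
have E0 : E 0.
  by rewrite /E big1 ?pdot0l ?scale0r ?addr0// => b _; rewrite pdot0l scale0r.
have EF b : b \in s -> E (F b).
  move=> bs; rewrite /E F'z [B _ g]pdotC gF// scale0r addr0.
  rewrite (bigD1_seq b)//= F's// Fo// eqxx scale1r big_seq_cond big1 ?addr0//.
  move=> b' /andP[b's b'b].
  by rewrite F's// Fo// eq_sym (negbTE b'b) scale0r.
have Eg : E g.
  rewrite /E F'z gg scale1r big_seq big1 ?add0r// => b bs.
  by rewrite F's// gF// scale0r.
have Esum (t : seq (multinom d)) (c : multinom d -> R) : {subset t <= s} ->
    E (\sum_(b <- t) c b *: F b).
  elim: t => [|b t ih] ts; first by rewrite big_nil.
  rewrite big_cons; apply: Elin; first by apply: EF; apply: ts; rewrite inE eqxx.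
  by apply: ih => b' b't; apply: ts; rewrite inE b't orbT.
have EX : E X.
  have -> : X = n *: g + \sum_(b <- s) B X (F b) *: F b.
    by rewrite /g scalerA mulfV// scale1r /r subrK.
  by apply: Elin => //; apply: Esum.
have -> : p = mcoeff z p *: X + (p - mcoeff z p *: X) by rewrite addrC subrK.
apply: Elin => //; set q := p - _.
rewrite (Fp k q); last first.
  move=> b; rewrite mcoeffB mcoeffZ mcoeffX; have [<-|zb] := eqVneq z b.
    by rewrite mulr1 subrr eqxx.
  rewrite mulr0 subr0 => /pk[]; rewrite mem_rcons inE eq_sym (negbTE zb)/=.
  by [].
by rewrite cond; apply: Esum.
Qed.

Lemma mcoeff_msize p m b : (msize p <= m)%N -> mcoeff b p != 0 -> (mdeg b < m)%N.
Proof.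
move=> pm; rewrite -mcoeff_msupp => bp.
exact: leq_trans (mmeasure_mnm_lt mdeg bp) pm.
Qed.

Lemma msize_le p m : (forall b, mcoeff b p != 0 -> (mdeg b < m)%N) -> (msize p <= m)%N.
Proof.
by move=> pm; rewrite mmeasureE; apply/bigmax_leqP_seq => b bp _; apply: pm; rewrite -mcoeff_msupp.
Qed.

(** The Gram-Schmidt basis of all the polynomials of degree at most
    [m] is adapted to the degree, so its members of degree [m] form a basis of the orthogonal
    complement. *)
Lemma orthonormal_basis_exists m : exists P, orthonormal_basis nu m P.
Proof.
pose s : seq (multinom d) := sort (fun a b => mdeg a <= mdeg b)%N (map val (enum {: bmultinom d m.+1})).
have us : uniq s by rewrite sort_uniq map_inj_uniq ?enum_uniq//; exact: val_inj.
have ps : pairwise (fun a b => mdeg a <= mdeg b)%N s.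
  rewrite -sorted_pairwise; last by move=> a b c; exact: leq_trans.
  by apply: sort_sorted => a b; exact: leq_total.
have ms b : (b \in s) = (mdeg b < m.+1)%N.
  rewrite mem_sort; apply/mapP/idP => [[c _ ->]|bm]; first exact: bmdeg.
  by exists (BMultinom bm); rewrite ?mem_enum.
have [F [Fo Fs Fp]] := gram_schmidt us ps.
have FF a b : mdeg a = m -> mdeg b = m -> B (F a) (F b) = (a == b)%:R.
  by move=> am bm; rewrite Fo// ms ?am ?bm.
have Fsz a : a \in s -> (msize (F a) <= (mdeg a).+1)%N.
  by move=> as_; apply: msize_le => b /(Fs _ as_)[].
have low a q : mdeg a = m -> (msize q <= m)%N -> B (F a) q = 0.
  move=> am qm; rewrite (Fp m q); last first.
    by move=> b bq; have bm := mcoeff_msize qm bq; rewrite ms ltnS (ltnW bm).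
  rewrite pdotC pdot_suml big_seq_cond big1// => b /andP[bs bm].
  rewrite pdotZl Fo// ?ms ?am// (_ : (b == a) = false) ?mulr0//.
  by apply/eqP => ba; rewrite ba am ltnn in bm.
exists F; split => //.
- move=> a am; right; split; last by move=> q; exact: low.
  apply/eqP; rewrite eqn_leq; apply/andP; split.
    by rewrite -am Fsz// ms am.
  rewrite ltnNge; apply/negP => /(low a _ am); rewrite FF// eqxx.
  by move/eqP; rewrite oner_eq0.
move=> p [->|[pm plow]].
  by exists (fun=> 0); rewrite big1// => a _; rewrite scale0r.
exists (fun a => B p (F a)).
rewrite {1}(Fp m.+1 p); last first.
  by move=> b bp; have := mcoeff_msize (leqnn _) bp; rewrite pm ms.
rewrite (perm_big (map val (enum {: bmultinom d m.+1}))) /=; last by rewrite perm_sort.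
rewrite big_map big_enum_cond /= (eq_bigl predT) ?[RHS]big_mkcond; last first.
  by move=> a; rewrite bmdeg.
apply: eq_bigr => a _; case: eqP => // /eqP am.
have {}am : (mdeg (bmnm a) < m)%N by rewrite ltn_neqAle am -ltnS bmdeg.
rewrite plow ?scale0r//; apply: leq_trans am.
by apply: Fsz; rewrite ms bmdeg.
Qed.

(** Indexed by all multi-indices, the bases of the various degrees that
    [ortho_kernel] chooses. *)
Definition obasis a : poly := xget (fun=> 0) [set P | orthonormal_basis nu (mdeg a) P] a.

Let obasisP m : exists2 P, orthonormal_basis nu m P &
  [set P | orthonormal_basis nu m P] (xget (fun=> 0) [set P | orthonormal_basis nu m P]).
Proof. by have [P hP] := orthonormal_basis_exists m; exists P => //; exact: xgetI hP. Qed.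

Let obasis_ortho a : ortho_space nu (mdeg a) (obasis a).
Proof. by rewrite /obasis; have [_ _ [H _ _]] := obasisP (mdeg a); exact: H. Qed.

Let obasis_norm a b : mdeg a = mdeg b -> B (obasis a) (obasis b) = (a == b)%:R.
Proof.
by move=> ab; rewrite /obasis ab; have [_ _ [_ H _]] := obasisP (mdeg b); exact: H.
Qed.

Let obasis_size a : msize (obasis a) = (mdeg a).+1 /\
  forall q, (msize q <= mdeg a)%N -> B (obasis a) q = 0.
Proof.
case: (obasis_ortho a) => // f0; have := obasis_norm (erefl (mdeg a)).
by rewrite eqxx f0 pdot0l => /eqP; rewrite eq_sym oner_eq0.
Qed.

Lemma msize_obasis a : msize (obasis a) = (mdeg a).+1.
Proof. by case: (obasis_size a). Qed.

Lemma pdot_obasis a b : B (obasis a) (obasis b) = (a == b)%:R.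
Proof.
have [ab|ba|/obasis_norm//] := ltngtP (mdeg a) (mdeg b).
  have [_ H] := obasis_size b; rewrite pdotC H ?msize_obasis//.
  by case: eqP ab => // ->; rewrite ltnn.
have [_ H] := obasis_size a; rewrite H ?msize_obasis//.
by case: eqP ba => // ->; rewrite ltnn.
Qed.

Lemma sum_bmultinomS (V : nmodType) N (F : multinom d -> V) :
  \sum_(a : bmultinom d N.+1) F a =
  \sum_(a : bmultinom d N) F a + \sum_(a : bmultinom d N.+1 | mdeg a == N) F a.
Proof.
rewrite (bigID (fun a : bmultinom d N.+1 => mdeg a == N)) /= addrC; congr (_ + _).
have sub : forall a : multinom d, (mdeg a < N)%N -> (mdeg a < N.+1)%N by move=> a /ltnW.
have := ssrcomplements.big_sub_widen (bmultinom d N) (bmultinom d N.+1) predT F sub.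
move=> /= ->; apply: eq_bigl => a; rewrite ltn_neqAle -ltnS bmdeg andbT.
by [].
Qed.

(** By induction on the degree: after subtracting the projection to lower degree,
    what remains is orthogonal to the polynomials of lower degree, so it is [0] or has top
    degree, and then it is a combination of the last basis. *)
Lemma obasis_span N p : (msize p <= N)%N ->
  p = \sum_(a : bmultinom d N) B p (obasis a) *: obasis a.
Proof.
elim: N p => [|N IH] p pN.
  rewrite big1 => [|[a aN]//]; apply/eqP; rewrite -(mmeasure_poly_eq0 mdeg).
  by rewrite -leqn0.
pose q := p - \sum_(a : bmultinom d N) B p (obasis a) *: obasis a.
have qa (a : bmultinom d N) : B q (obasis a) = 0.
  rewrite /q pdotBl pdot_suml (bigD1 a)//= pdotZl pdot_obasis eqxx mulr1.
  rewrite big1 ?addr0 ?subrr// => b ba; rewrite pdotZl pdot_obasis -bmeqP (negbTE ba).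
  by rewrite mulr0.
have qlow r : (msize r <= N)%N -> B q r = 0.
  move=> rN; rewrite (IH _ rN) pdotC pdot_suml big1// => a _.
  by rewrite pdotZl (pdotC (obasis a)) qa mulr0.
have qN : (msize q <= N.+1)%N.
  apply: msize_le => b; rewrite mcoeffB raddf_sum /= => H.
  have [/mcoeff_msize-/(_ _ pN)//|pb] := boolP (mcoeff b p != 0).
  move: H; rewrite (eqP (negPn pb)) sub0r oppr_eq0 => H.
  rewrite ltnNge; apply/negP => Nb; case/eqP: H; rewrite big1// => a _.
  rewrite mcoeffZ (_ : mcoeff b _ = 0) ?mulr0//; apply/eqP.
  apply: contraT => /(mcoeff_msize (leqnn _)); rewrite msize_obasis ltnS => ba.
  by have := leq_ltn_trans ba (bmdeg a); rewrite ltnNge (ltnW Nb).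
have qO : ortho_space nu N q.
  move: qN; rewrite leq_eqVlt => /orP[/eqP qN|qN]; first by right.
  by left; apply: pdot_eq0; apply: qlow.
have [c qc] : exists c : multinom d -> R,
    q = \sum_(a : bmultinom d N.+1 | mdeg a == N) c a *: obasis a.
  have [_ _ [_ _ /(_ q qO) [c ->]]] := obasisP N.
  by exists c; apply: eq_bigr => a /eqP aN; rewrite /obasis aN.
have pE : p = \sum_(a : bmultinom d N) B p (obasis a) *: obasis a + q by rewrite addrC subrK.
rewrite (sum_bmultinomS N (fun a => B p (obasis a) *: obasis a)) {1}pE; congr (_ + _).
rewrite {1}qc; apply: eq_bigr => a /eqP aN.
congr (_ *: _); rewrite [in RHS]pE pdotDl pdot_suml big1 ?add0r; last first.
  move=> b _; rewrite pdotZl pdot_obasis (_ : (_ == _) = false) ?mulr0//.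
  by apply/eqP => ba; have := bmdeg b; rewrite ba aN ltnn.
rewrite qc pdot_suml (bigD1 a)/= ?aN// pdotZl pdot_obasis eqxx mulr1.
rewrite big1 ?addr0// => b /andP[_ ba]; rewrite pdotZl pdot_obasis -bmeqP (negbTE ba).
by rewrite mulr0.
Qed.

(** The diagonal of the reproducing kernel of the polynomials of degree less than
    [N]; the strict bound makes [0] stand for the zero space. *)
Definition total_kernel N (x : d.-tuple R) : R :=
  \sum_(a : bmultinom d N) peval (obasis a) x ^+ 2.

Lemma total_kernelS N x : total_kernel N.+1 x = total_kernel N x + ortho_kernel nu N x x.
Proof.
rewrite /total_kernel (sum_bmultinomS N (fun a => peval (obasis a) x ^+ 2)); congr (_ + _).
by apply: eq_bigr => a /eqP aN; rewrite /obasis aN.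
Qed.

Lemma total_kernel0 x : total_kernel 0 x = 0.
Proof. by rewrite /total_kernel big1// => -[]. Qed.

(** The infimum is attained at the kernel function of [x] divided by its value at
    [x]; that no other polynomial does better is the Cauchy-Schwarz inequality, here as
    the nonnegativity of a sum of squares. *)
Lemma christoffelE N x : christoffel nu N x = (total_kernel N.+1 x)^-1.
Proof.
set K := total_kernel _ _.
pose co p a := B p (obasis a).
have peE p : (msize p <= N.+1)%N -> peval p x = \sum_(a : bmultinom d N.+1) co p a * peval (obasis a) x.
  move=> pN; rewrite {1}(obasis_span pN) /peval raddf_sum /=.
  by apply: eq_bigr => a _; exact: mevalZ.
have ppE p : (msize p <= N.+1)%N -> B p p = \sum_(a : bmultinom d N.+1) co p a ^+ 2.
  move=> pN; rewrite {1}(obasis_span pN) pdot_suml; apply: eq_bigr => a _.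
  by rewrite pdotZl (pdotC (obasis a)) expr2.
have K0 : 0 <= K by apply: sumr_ge0 => a _; exact: sqr_ge0.
have K_gt0 : 0 < K.
  rewrite lt_neqAle K0 andbT eq_sym; apply/eqP => KE.
  have /psumr_eq0P z := KE.
  have := peE 1; rewrite (_ : peval 1 x = 1); last exact: meval1.
  rewrite mmeasure1 => /(_ isT); rewrite big1; first by move/eqP; rewrite oner_eq0.
  move=> a _; apply/eqP; rewrite mulf_eq0 -(sqrf_eq0 (peval _ _)); apply/orP; right.
  by apply/eqP; apply: z => // b _; exact: sqr_ge0.
pose p0 : poly := K^-1 *: \sum_(a : bmultinom d N.+1) peval (obasis a) x *: obasis a.
have p0N : (msize p0 <= N.+1)%N.
  apply: leq_trans (mmeasureZ_le _ _ _) _; apply: leq_trans (mmeasure_sum _ _ _ _) _.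
  apply/bigmax_leqP => a _; apply: leq_trans (mmeasureZ_le _ _ _) _.
  by rewrite msize_obasis bmdeg.
have cop0 (a : bmultinom d N.+1) : co p0 a = K^-1 * peval (obasis a) x.
  rewrite /co /p0 pdotZl pdot_suml (bigD1 a)//= pdotZl pdot_obasis eqxx mulr1.
  rewrite big1 ?addr0// => b ba; rewrite pdotZl pdot_obasis -bmeqP (negbTE ba).
  by rewrite mulr0.
have p0x : peval p0 x = 1.
  rewrite peE//; under eq_bigr do rewrite cop0 -mulrA -expr2.
  by rewrite -mulr_sumr mulVf// gt_eqF.
have p0p0 : B p0 p0 = K^-1.
  rewrite ppE//; under eq_bigr do rewrite cop0 exprMn.
  by rewrite -mulr_sumr expr2 -mulrA mulVf ?mulr1// gt_eqF.
have lb : lbound [set B p p | p in [set p | (msize p <= N.+1)%N /\ peval p x = 1]] K^-1.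
  move=> _ [p [pN px] <-]; rewrite ppE//.
  have : 0 <= \sum_(a : bmultinom d N.+1) (co p a - K^-1 * peval (obasis a) x) ^+ 2.
    by apply: sumr_ge0 => a _; exact: sqr_ge0.
  rewrite (eq_bigr (fun a : bmultinom d N.+1 => (co p a ^+ 2 +
    - (2 * K^-1) * (co p a * peval (obasis a) x)) + K^-1 ^+ 2 * peval (obasis a) x ^+ 2)); last first.
    by move=> a _; ring.
  rewrite 2!big_split /= -!mulr_sumr -peE// px -/(total_kernel N.+1 x) -/K.
  rewrite (_ : - (2 * K^-1) * 1 = - K^-1 - K^-1); last by ring.
  by rewrite expr2 -mulrA mulVf ?gt_eqF// mulr1 -addrA subrK subr_ge0.
apply/eqP; rewrite eq_le; apply/andP; split.
  rewrite -p0p0; apply: inf_lbound; first by exists K^-1.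
  by exists p0.
by apply: lb_le_inf => //; exists (B p0 p0); exists p0.
Qed.

End ortho.

(** * Infinitesimal rotations of the sphere *)

Section rotations.
Context (R : realType) (d : nat).
Local Notation poly := (mpoly d R).
Local Notation "'X_ i" := (mpolyX R (mnm1 i)) (at level 8, i at level 2).
Local Notation Y := (last_coord R d).
Local Notation msize p := (mmeasure mdeg p).
Local Notation wid := (widen_ord (leqnSn d)).
Implicit Types (p q : poly) (e : d.+1.-tuple bool) (i : 'I_d).

Definition flip i e : d.+1.-tuple bool :=
  [tuple tnth e j (+) ((j == wid i) || (j == ord_max)) | j < d.+1].

Lemma flipK i : involutive (flip i).
Proof. by move=> e; apply: eq_from_tnth => j; rewrite !tnth_mktuple addbK. Qed.

Lemma wid_neq_max i : (wid i == ord_max) = false.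
Proof. by apply/eqP => /(congr1 val) /= iE; have := ltn_ord i; rewrite iE ltnn. Qed.

Lemma flip_wid i e : tnth (flip i e) (wid i) = ~~ tnth e (wid i).
Proof. by rewrite tnth_mktuple eqxx addbT. Qed.

Lemma flip_max i e : tnth (flip i e) ord_max = ~~ tnth e ord_max.
Proof. by rewrite tnth_mktuple eqxx orbT addbT. Qed.

Lemma flip_other i j e : j != i -> tnth (flip i e) (wid j) = tnth e (wid j).
Proof.
move=> ji; rewrite tnth_mktuple wid_neq_max orbF (_ : (_ == _) = false) ?addbF//.
by apply/eqP => /(congr1 val) /= /val_inj /eqP; rewrite (negbTE ji).
Qed.

(** The part of [g_e] that the rotation [D_i] does not differentiate; it is common to [e]
    and [flip i e]. *)
Definition gpoly_off i e : poly := \prod_(j < d | j != i) 'X_j ^+ tnth e (wid j).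

Lemma gpoly_off_flip i e : gpoly_off i (flip i e) = gpoly_off i e.
Proof. by apply: eq_bigr => j ji; rewrite flip_other. Qed.

Lemma gpolyE i e :
  gpoly R e = gpoly_off i e * ('X_i ^+ tnth e (wid i) * Y ^+ tnth e ord_max).
Proof. by rewrite /gpoly (bigD1 i)//= mulrA [X in X * _]mulrC. Qed.

Lemma mderivXU i j : mderiv i ('X_j : poly) = (j == i)%:R.
Proof.
rewrite mderivX mnm1E; case: eqP => [->|_]; last by rewrite scale0r.
rewrite scale1r (_ : mnm_sub _ _ = @mnm0 d) ?mpolyX0//.
by apply/mnmP => k; rewrite mnmBE mnm0E subnn.
Qed.

Lemma mderiv1 i : mderiv i (1 : poly) = 0.
Proof. by rewrite -mpolyC1 mderivC. Qed.

Lemma mderiv_gpoly_off i e : mderiv i (gpoly_off i e) = 0.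
Proof.
rewrite /gpoly_off; elim/big_rec: _ => [|j p ji ih]; first exact: mderiv1.
rewrite mderivM ih mulr0 addr0; case: (tnth e _); last by rewrite expr0 mderiv1 mul0r.
by rewrite expr1 mderivXU (negbTE ji) mul0r.
Qed.

Lemma mderiv_last i : mderiv i Y = -1.
Proof.
rewrite mderivB mderiv1 sub0r; congr (- _).
rewrite (_ : mderiv i _ = \sum_(j < d) mderiv i (mpolyX R (mnm1 j))); last exact: raddf_sum.
rewrite (bigD1 i)//= mderivXU eqxx.
by rewrite big1 ?addr0// => j ji; rewrite mderivXU (negbTE ji).
Qed.

(** The operator [T] such that [D_i (u^e p) = u^e' (T p)], where [D_i] is the field
    [u_i d_(d+1) - u_(d+1) d_i] and [e' = flip i e]. *)
Definition rotation i e p : poly :=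
  let a := tnth e (wid i) in let b := tnth e ord_max in
  (b%:R * 'X_i ^+ a - a%:R * Y ^+ b) * p - 2 *: ('X_i ^+ a * Y ^+ b * mderiv i p).

(** The identity [D_i ((u^e q)^2) = 2 (u^e q) D_i (u^e q)], divided by
    [2 u_i u_(d+1)]. *)
Lemma mderiv_gpoly_sqr i e q :
  mderiv i (gpoly R e * q * q) = - (gpoly_off i e * q * rotation i e q).
Proof.
rewrite (gpolyE i) /rotation -mul_mpolyC !mderivM mderiv_gpoly_off.
rewrite (_ : mpolyC d (2 : R) = 2); last by rewrite mpolyC_nat.
by case: (tnth e (wid i)); case: (tnth e ord_max);
  rewrite /= ?expr1 ?expr0 ?mderivXU ?eqxx ?mderiv_last ?mderiv1 /= ?mulr1n; ring.
Qed.

(** Skew-adjointness of [D_i]: the sum of the two integrands is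
    [D_i (u^e p u^e' q)], and [u^e u^e'] is [u_i u_(d+1)] times [gpoly_off i e]. *)
Lemma rotation_adjoint i e p q :
  pdot (gequilibrium R (flip i e)) (rotation i e p) q =
  - pdot (gequilibrium R e) p (rotation i (flip i e) q).
Proof.
apply/eqP; rewrite -addr_eq0 !pdot_gequilibrium -raddfD /=; apply/eqP.
rewrite -[RHS](eqint_by_parts i (gpoly_off i e * p * q)); congr eqint.
rewrite !(gpolyE i) gpoly_off_flip flip_wid flip_max /rotation flip_wid flip_max.
rewrite -!mul_mpolyC !mderivM mderiv_gpoly_off.
rewrite (_ : mpolyC d (2 : R) = 2); last by rewrite mpolyC_nat.
by case: (tnth e (wid i)); case: (tnth e ord_max); rewrite /= ?expr1 ?expr0; ring.
Qed.

Lemma abs_epsE i e : abs_eps e =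
  (tnth e (wid i) + tnth e ord_max + \sum_(j < d | j != i) tnth e (wid j))%N.
Proof.
by rewrite /abs_eps big_ord_recr /= (bigD1 i)//= addnAC.
Qed.

Lemma abs_eps_flip i e :
  (abs_eps (flip i e) + 2 * (tnth e (wid i) + tnth e ord_max) = abs_eps e + 2)%N.
Proof.
rewrite !(abs_epsE i) flip_wid flip_max.
rewrite (eq_bigr (fun j => nat_of_bool (tnth e (wid j)))); last by move=> j ji; rewrite flip_other.
by case: (tnth e (wid i)); case: (tnth e ord_max); rewrite /=; lia.
Qed.

Lemma odd_abs_eps_flip i e : odd (abs_eps (flip i e)) = odd (abs_eps e).
Proof.
have /(congr1 odd) := abs_eps_flip i e.
by rewrite oddD mul2n odd_double addbF oddD addbF.
Qed.

Lemma msizeM_le p q m n : (msize p <= m.+1)%N -> (msize q <= n)%N ->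
  (msize (p * q) <= m + n)%N.
Proof.
move=> pm qn; have [->|p0] := eqVneq p 0; first by rewrite mul0r mmeasure0.
have [->|q0] := eqVneq q 0; first by rewrite mulr0 mmeasure0.
by rewrite (msizeM p0 q0) -subn1 leq_subLR add1n -addSn leq_add.
Qed.

Lemma msizeD_le p q m : (msize p <= m)%N -> (msize q <= m)%N -> (msize (p + q) <= m)%N.
Proof. by move=> pm qm; apply: leq_trans (mmeasureD_le _ _ _) _; rewrite geq_max pm. Qed.

Lemma msize_mderiv i p n : (msize p <= n)%N -> (msize (mderiv i p) <= n.-1)%N.
Proof.
move=> pn; apply: msize_le => b; rewrite mcoeff_deriv => H.
have /(mcoeff_msize pn) : mcoeff (mnm_add b (mnm1 i)) p != 0.
  by apply: contraNN H => /eqP ->; rewrite mul0rn.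
by rewrite mdegD mdeg1; lia.
Qed.

Lemma msize_X_exp i (a : bool) : (msize ('X_i ^+ a : poly) <= a.+1)%N.
Proof. by case: a; rewrite ?expr1 ?expr0 ?mmeasure1 // msizeX mdeg1. Qed.

Lemma msize_Y_exp (b : bool) : (msize (Y ^+ b) <= b.+1)%N.
Proof.
case: b; rewrite ?expr0 ?mmeasure1// expr1 /last_coord; apply: msizeD_le.
  by rewrite mmeasure1.
rewrite mmeasureN; apply: leq_trans (mmeasure_sum _ _ _ _) _.
by apply/bigmax_leqP => j _; rewrite msizeX mdeg1.
Qed.

(** On the sphere [D_i] preserves the space of polynomials of degree at most
    [2n].  The bound is stated with truncated subtraction, so that it also covers
    [|e| = 2n] with both entries of [e] at [0]: there [p] is constant, [flip i e] has weight
    [2n + 2], and the conclusion says that [rotation i e p] is zero. *)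
Lemma msize_rotation i e p n : ~~ odd (abs_eps e) ->
  (msize p <= n.+1 - (abs_eps e)./2)%N ->
  (msize (rotation i e p) <= n.+1 - (abs_eps (flip i e))./2)%N.
Proof.
move=> oe pn; have [->|p0] := eqVneq p 0.
  by rewrite /rotation mulr0 raddf0 mulr0 scaler0 subr0 mmeasure0.
have p1 : (0 < msize p)%N by rewrite lt0n mmeasure_poly_eq0.
have oe' := oe; rewrite -(odd_abs_eps_flip i) in oe'.
have E := abs_eps_flip i e; rewrite /rotation.
set a := tnth e (wid i) in E *; set b := tnth e ord_max in E *.
set k := (n.+1 - (abs_eps e)./2)%N in pn.
have sz2 : (msize (2 *: ('X_i ^+ a * Y ^+ b * mderiv i p)) <= (a + b + k).-1)%N.
  apply: leq_trans (mmeasureZ_le _ _ _) _.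
  have -> : (a + b + k).-1 = (a + b + k.-1)%N by lia.
  apply: msizeM_le; last exact: msize_mderiv.
  by rewrite -addnS; apply: msizeM_le; [exact: msize_X_exp|exact: msize_Y_exp].
apply: msizeD_le; last first.
  by rewrite mmeasureN; apply: leq_trans sz2 _; lia.
have x1 : (msize ('X_i : poly) <= 2)%N := msize_X_exp i true.
have y1 : (msize Y <= 2)%N := msize_Y_exp true.
clearbody a b; case: a b E {sz2} => -[] /= E; rewrite ?expr1 ?expr0.
- apply: leq_trans (_ : 1 + k <= _)%N; last by lia.
  by apply: msizeM_le => //; rewrite !mul1r; apply: msizeD_le; rewrite ?mmeasureN.
- rewrite mul0r sub0r mulr1 mulNr mul1r mmeasureN; apply: leq_trans pn _; lia.
- rewrite mul0r subr0 mulr1 mul1r; apply: leq_trans pn _; lia.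
- by rewrite !mul0r subr0 mul0r mmeasure0.
Qed.

End rotations.

(** * The sum of the kernels is constant *)

Section constancy.
Context (R : realType) (d : nat).
Local Notation poly := (mpoly d R).
Local Notation msize p := (mmeasure mdeg p).
Implicit Types (p q : poly) (e : d.+1.-tuple bool) (i : 'I_d).
Local Notation nu e := (gequilibrium R e).

Lemma pdot_gequilibrium_scalar e q : scalar (fun p => pdot (nu e) p q).
Proof.
move=> c p p'; rewrite /= !pdot_gequilibrium mulrDr mulrDl -scalerAr -scalerAl.
by rewrite linearP.
Qed.

Lemma pdot_gequilibrium_gt0 e p : p != 0 -> 0 < pdot (nu e) p p.
Proof. by move=> p0; rewrite pdot_gequilibrium eqint_gt0. Qed.

Local Notation f e := (obasis (nu e)).

(** The sum of [g_e] times the diagonal kernels, as a polynomial.  The weights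
    with [|e| >= 2n] contribute empty sums, so no bound on [|e|] is imposed. *)
Definition kernel_sum n : poly :=
  \sum_(e : d.+1.-tuple bool | ~~ odd (abs_eps e))
    \sum_(a : bmultinom d (n - (abs_eps e)./2)) gpoly R e * f e a * f e a.

(** The derivative is, up to sign, the sum over [e], [a] and [b] of
    [A_ab f_a f_b] with [f_a], [f_b] in the bases for [e] and [flip i e], and [A] the matrix of
    [rotation].  Exchanging [e] with [flip i e] exchanges [a] and [b], and [A] is
    skew-symmetric by [rotation_adjoint]. *)
Lemma mderiv_kernel_sum n i : mderiv i (kernel_sum n.+1) = 0.
Proof.
pose A e e' (a b : multinom d) := pdot (nu e') (rotation i e (f e a)) (f e' b).
have AE e a b : A e (flip i e) a b = - A (flip i e) e b a.
  by rewrite /A rotation_adjoint pdotC.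
pose N e := (n.+1 - (abs_eps e)./2)%N.
pose G e e' := \sum_(a : bmultinom d (N e)) \sum_(b : bmultinom d (N e'))
  A e e' a b *: (gpoly_off R i e * f e a * f e' b).
pose S := \sum_(e : d.+1.-tuple bool | ~~ odd (abs_eps e)) G e (flip i e).
have FS : mderiv i (kernel_sum n.+1) = - S.
  rewrite /kernel_sum (_ : mderiv i _ = \sum_(e : d.+1.-tuple bool | ~~ odd (abs_eps e))
     \sum_(a : bmultinom d (N e)) mderiv i (gpoly R e * f e a * f e a)); last first.
    rewrite [LHS]raddf_sum; apply: eq_bigr => e _; exact: raddf_sum.
  rewrite /S -sumrN; apply: eq_bigr => e oe; rewrite /G -sumrN; apply: eq_bigr => a _.
  rewrite mderiv_gpoly_sqr; congr (- _).
  have sz : (msize (rotation i e (f e a)) <= N (flip i e))%N.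
    apply: msize_rotation => //; rewrite (msize_obasis (pdot_gequilibrium_scalar e) (@pdot_gequilibrium_gt0 e)).
    exact: bmdeg.
  rewrite {1}(obasis_span (pdot_gequilibrium_scalar (flip i e)) (@pdot_gequilibrium_gt0 (flip i e)) sz).
  by rewrite mulr_sumr; apply: eq_bigr => b _; rewrite -scalerAr.
(* The involution flip i exchanges the two bases. *)
have SN : S = - S.
  rewrite {1}/S (reindex_inj (inv_inj (flipK i))) /= /S -sumrN.
  apply: eq_big => [e|e _]; first by rewrite odd_abs_eps_flip.
  rewrite flipK /G exchange_big -sumrN; apply: eq_bigr => a _.
  rewrite -sumrN; apply: eq_bigr => b _; rewrite gpoly_off_flip.
  by rewrite AE scaleNr opprK mulrAC.
have S0 : 2 *: S = 0 by rewrite scaler_nat mulr2n {1}SN addNr.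
by move/eqP: S0; rewrite FS scaler_eq0 pnatr_eq0 /= => /eqP ->; rewrite oppr0.
Qed.

Lemma mderiv_eq0 p : (forall i, mderiv i p = 0) -> p = mpolyC d (mcoeff (@mnm0 d) p).
Proof.
move=> dp; apply/mpolyP => m; rewrite mcoeffC; have [->|m0] := eqVneq m (@mnm0 d).
  by rewrite mulr1.
rewrite mulr0; have [i mi] : exists i, (0 < m i)%N.
  apply: contrapT => nm; case/eqP: m0; apply/mnmP => i; rewrite mnm0E; apply/eqP.
  by rewrite -leqn0 leqNgt; apply/negP => mi; apply: nm; exists i.
have := congr1 (mcoeff (mnm_sub m (mnm1 i))) (dp i).
rewrite mcoeff_deriv mcoeff0 (_ : mnm_add _ _ = m); last first.
  apply/mnmP => j; rewrite mnmDE mnmBE mnm1E; case: eqP => [<-|_]; last by rewrite subn0 addn0.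
  by rewrite subnK.
by move/eqP; rewrite mulrn_eq0 => /eqP.
Qed.

Lemma peval_kernel_sum n x : peval (kernel_sum n) x =
  \sum_(e : d.+1.-tuple bool | ~~ odd (abs_eps e))
    gfun e x * total_kernel (nu e) (n - (abs_eps e)./2) x.
Proof.
rewrite peval_sum; apply: eq_bigr => e _; rewrite peval_sum /total_kernel mulr_sumr.
by apply: eq_bigr => a _; rewrite peval_gpolyM -mulrA expr2.
Qed.

(** A polynomial with zero derivatives is constant, hence equal to its integral
    against the probability measure mu; each [g_e f_a^2] has integral [1]. *)
Lemma kernel_sum_const n x : peval (kernel_sum n.+1) x =
  (\sum_(e : d.+1.-tuple bool | ~~ odd (abs_eps e)) #|{: bmultinom d (n.+1 - (abs_eps e)./2)}|)%:R.
Proof.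
have FC := mderiv_eq0 (mderiv_kernel_sum n).
rewrite FC /peval mevalC.
transitivity (eqint (kernel_sum n.+1)).
  by rewrite [in RHS]FC -[mpolyC _ _]mulr1 mul_mpolyC linearZ /= eqint1 mulr1.
have eqint_sum I (r : seq I) (P : pred I) (F : I -> poly) :
  eqint (\sum_(j <- r | P j) F j) = \sum_(j <- r | P j) eqint (F j) by exact: raddf_sum.
rewrite eqint_sum natr_sum; apply: eq_bigr => e _.
rewrite eqint_sum -sum1_card natr_sum; apply: eq_bigr => a _.
rewrite -pdot_gequilibrium (pdot_obasis (pdot_gequilibrium_scalar e) (@pdot_gequilibrium_gt0 e)).
by rewrite eqxx.
Qed.

End constancy.

Lemma sum_total_kernel (R : realType) (d n : nat) (x : d.-tuple R) :
  \sum_(e : d.+1.-tuple bool | ~~ odd (abs_eps e) && (abs_eps e <= 2 * n)%N)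
    gfun e x * total_kernel (gequilibrium R e) (n - (abs_eps e)./2).+1 x =
  'C(2 * n + d, d)%:R.
Proof.
rewrite -sum_card_bmultinom -(kernel_sum_const n x) peval_kernel_sum [RHS](bigID (fun e => abs_eps e <= 2 * n)%N) /=.
rewrite [X in _ + X]big1 ?addr0 => [|e /andP[oe en]].
  apply: eq_bigr => e /andP[oe en]; rewrite subSn//.
  by have := even_halfK oe; lia.
rewrite (_ : _ - _ = 0)%N ?total_kernel0 ?mulr0//.
by have := even_halfK oe; lia.
Qed.

(** The same sum with every degree lowered by one is the instance [n - 1]
    of [sum_total_kernel]: the weights with [|e| = 2n] now contribute [0]. *)
Lemma sum_total_kernel_pred (R : realType) (d n : nat) (x : d.-tuple R) :
  \sum_(e : d.+1.-tuple bool | ~~ odd (abs_eps e) && (abs_eps e <= 2 * n)%N)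
    gfun e x * total_kernel (gequilibrium R e) (n - (abs_eps e)./2) x =
  if n is k.+1 then 'C(2 * k + d, d)%:R else 0.
Proof.
case: n => [|n].
  by apply: big1 => e _; rewrite sub0n total_kernel0 mulr0.
rewrite -(sum_total_kernel n x) [LHS](bigID (fun e => abs_eps e <= 2 * n)%N) /=.
rewrite [X in _ + X]big1 ?addr0 => [|e /andP[/andP[oe _] en]].
  apply: eq_big => [e|e /andP[/andP[oe _] en]].
    by case: (boolP (odd _)) => //= oe; lia.
  by rewrite subSn//; have := even_halfK oe; lia.
rewrite (_ : _ - _ = 0)%N ?total_kernel0 ?mulr0//.
by have := even_halfK oe; lia.
Qed.

Theorem theorem4p3 (R : realType) (d : nat) (hd : (1 <= d)%N) :
  (forall (m : nat) (x : d.-tuple R),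
    \sum_(e : d.+1.-tuple bool | ~~ odd (abs_eps e) && (abs_eps e <= 2 * m)%N)
        gfun e x * ortho_kernel (gequilibrium R e) (m - (abs_eps e)./2)%N x x
    = (binz ((2 * m + d)%N%:Z - 1) (d - 1) +
       binz ((2 * m + d)%N%:Z - 2) (d - 1))%N%:R) /\
  (forall (n : nat) (x : d.-tuple R),
    \sum_(e : d.+1.-tuple bool | ~~ odd (abs_eps e) && (abs_eps e <= 2 * n)%N)
        gfun e x * (christoffel (gequilibrium R e) (n - (abs_eps e)./2)%N x)^-1
    = 'C(2 * n + d, d)%:R).
Proof.
have scal (e : d.+1.-tuple bool) := pdot_gequilibrium_scalar (R := R) e.
have pos (e : d.+1.-tuple bool) := @pdot_gequilibrium_gt0 R d e.
split=> n x; last first.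
  rewrite -(sum_total_kernel n x); apply: eq_bigr => e _.
  by rewrite (christoffelE (scal e) (pos e)) invrK.
(* The kernel of degree m is the difference of the kernels of degree at most m and m - 1. *)
transitivity ('C(2 * n + d, d)%:R - (if n is k.+1 then 'C(2 * k + d, d)%:R else 0) : R).
  rewrite -(sum_total_kernel n x) -(sum_total_kernel_pred n x) -sumrB.
  apply: eq_bigr => e _; rewrite -mulrBr total_kernelS.
  by rewrite addrAC subrr add0r.
apply/eqP; rewrite subr_eq; apply/eqP.
clear scal pos x; case: d hd => // d _; rewrite subn1 /=.
case: n => [|n].
  rewrite muln0 add0n addr0 binn.
  (* In dimension 1 the upper argument is -1. *)
  have -> : binz (d.+1%:Z - 2) d = 0%N.
    case: d => [//|d]; rewrite (_ : d.+2%:Z - 2 = d%:Z); last by lia.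
    by rewrite /binz bin_small.
  by rewrite (_ : d.+1%:Z - 1 = d%:Z) /binz ?binn//; lia.
rewrite (_ : (2 * n.+1 + d.+1)%N%:Z - 1 = (2 * n + d).+2%:Z); last by lia.
rewrite (_ : (2 * n.+1 + d.+1)%N%:Z - 2 = (2 * n + d).+1%:Z); last by lia.
rewrite /= -natrD; congr (_%:R).
rewrite (_ : 2 * n.+1 + d.+1 = (2 * n + d).+3)%N; last by lia.
by rewrite addnS binS ['C(_.+2, d.+1)]binS; lia.
Qed.
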